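(* Let $k$ be a field of characteristic $p>0$. (1) Let $q$ be a power of $p$. Then $\operatorname{PGL}_2(k)$ contains subgroups isomorphic to $\operatorname{PGL}_2(\mathbb{F}_q)$ and $\operatorname{PSL}_2(\mathbb{F}_q)$ if and only if $\mathbb{F}_q\subset k$. (2) Let $m\in\mathbb{N}$ and $n\in\mathbb{N}\smallsetminus p\mathbb{N}$, and let $e$ be the order of $p$ in $(\mathbb{Z}/n\mathbb{Z})^\times$. Then $\operatorname{PGL}_2(k)$ contains $p$-semi-elementary subgroups of order $p^m n$ if and only if $\mathbb{F}_{p^e}\subset k$ and $e\mid m\le \dim_{\mathbb{F}_p}(k)$. (3) If $p=2$ and $n\in\mathbb{N}$ is odd, then $\operatorname{PGL}_2(k)$ contains dihedral subgroups $\mathfrak{D}_n$ if and only if $\zeta+\zeta^{-1}\in k$ for some primitive $n$-th root of unity $\zeta$ (in a separable closure of $k$). (4) If $p=3$, then $\operatorname{PGL}_2(k)$ contains subgroups isomorphic to $\mathfrak{A}_5$ if and only if $\mathbb{F}_9\subset k$.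
   Context: $\operatorname{PGL}_2(k)=\mathrm{GL}_2(k)/k^\times$. The determinant induces a homomorphism $\overline{\det}:\operatorname{PGL}_2(k)\to k^\times/(k^\times)^2$, and $\operatorname{PSL}_2(k)$ denotes its kernel. $\mathfrak{D}_n$ is the dihedral group of order $2n$ and $\mathfrak{A}_n$ the alternating group on $n$ letters. A finite group $G$ is called $p$-semi-elementary if it has a unique Sylow $p$-subgroup $P$, $P$ has exponent $p$, and $G/P$ is cyclic. *)

(* Defs.v *)
From HB Require Import structures.
From mathcomp Require Import all_boot all_order all_fingroup all_algebra.
From mathcomp Require Import all_solvable all_field.
From mathcomp Require Import boolp.

Set Implicit Arguments.
Unset Strict Implicit.
Unset Printing Implicit Defensive.

Import GRing.Theory.

(* The group of units of a possibly infinite ring; the library only has       *)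
(* {unit R} for finite R. For a field k, units k is k^* and units 'M[k]_2 is  *)
(* GL_2(k).                                                                   *)
Section Units.
Variable R : unitRingType.
Local Open Scope ring_scope.

Record units := Units {
  units_val : R;
  units_valP : units_val \is a GRing.unit
}.
HB.instance Definition _ := [isSub for units_val].
HB.instance Definition _ := [Choice of units by <:].

Definition units_one : units := Units (unitr1 R).
Definition units_inv (u : units) : units :=
  Units (etrans (unitrV (val u)) (valP u)).
Lemma units_mul_subproof (u v : units) : val u * val v \is a GRing.unit.
Proof. by rewrite unitrMl ?(valP u) ?(valP v). Qed.
Definition units_mul (u v : units) : units := Units (units_mul_subproof u v).

Lemma units_mulA : associative units_mul.
Proof. by move=> u v w; apply/val_inj; rewrite /= mulrA. Qed.
Lemma units_mul1 : left_id units_one units_mul.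
Proof. by move=> u; apply/val_inj; rewrite /= mul1r. Qed.
Lemma units_mulr1 : right_id units_one units_mul.
Proof. by move=> u; apply/val_inj; rewrite /= mulr1. Qed.
Lemma units_mulV : left_inverse units_one units_inv units_mul.
Proof. by move=> u; apply/val_inj; rewrite /= mulVr ?(valP u). Qed.
Lemma units_mulrV : right_inverse units_one units_inv units_mul.
Proof. by move=> u; apply/val_inj; rewrite /= mulrV ?(valP u). Qed.

HB.instance Definition _ := isGroup.Build units
  units_mulA units_mul1 units_mulr1 units_mulV units_mulrV.
End Units.

(* Quotient of a possibly infinite group by a normal subgroup; the library's  *)
(* coset_of is restricted to finite groups.                                   *)
Record normal_subgroup (G : groupType) := NormalSubgroup {
  normal_pred :> {pred G};
  normal_pred_group : group_closed normal_pred;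
  normal_pred_conj :
    forall x y : G, x \in normal_pred -> (x ^ y)%g \in normal_pred
}.

Section QuotientGroup.
Variables (G : groupType) (N : normal_subgroup G).
Local Open Scope group_scope.
Local Open Scope quotient_scope.

Definition coset_eq (x y : G) : bool := x * y^-1 \in N.

Let N1 : 1 \in N. Proof. by case: (normal_pred_group N). Qed.
Let NV x : x \in N -> x^-1 \in N.
Proof. exact: (group_closedV (normal_pred_group N)). Qed.
Let NM x y : x \in N -> y \in N -> x * y \in N.
Proof. exact: (group_closedM (normal_pred_group N)). Qed.
Let NJ x y : x \in N -> x ^ y \in N.
Proof. exact: normal_pred_conj. Qed.

Lemma coset_eq_refl : reflexive coset_eq.
Proof. by move=> x; rewrite /coset_eq mulgV. Qed.
Lemma coset_eq_sym : symmetric coset_eq.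
Proof.
suff h x y : coset_eq x y -> coset_eq y x.
  by move=> x y; apply/idP/idP; apply: h.
by move/NV; rewrite /coset_eq invgM invgK.
Qed.
Lemma coset_eq_trans : transitive coset_eq.
Proof. by move=> y x z /NM xy /xy; rewrite /coset_eq mulgA mulgVK. Qed.

Canonical coset_equiv :=
  EquivRel coset_eq coset_eq_refl coset_eq_sym coset_eq_trans.

Definition quotg : Type := {eq_quot coset_eq}.
HB.instance Definition _ : EqQuotient _ coset_eq quotg :=
  EqQuotient.on quotg.
HB.instance Definition _ := Choice.on quotg.

Definition quot_pi (x : G) : quotg := \pi_quotg x.
Definition quot_repr (a : quotg) : G := generic_quotient.repr a.

Lemma quot_piP x y : reflect (quot_pi x = quot_pi y) (x * y^-1 \in N).
Proof. by apply: (iffP idP) => [h|/eqmodP//]; apply/eqmodP. Qed.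

Definition quotg_one : quotg := quot_pi 1.
Definition quotg_mul (a b : quotg) : quotg :=
  quot_pi (quot_repr a * quot_repr b).
Definition quotg_inv (a : quotg) : quotg := quot_pi (quot_repr a)^-1.

Lemma quot_reprK (a : quotg) : quot_pi (quot_repr a) = a.
Proof. exact: reprK. Qed.

Lemma quot_repr_pi x : quot_repr (quot_pi x) * x^-1 \in N.
Proof. by apply/quot_piP; rewrite quot_reprK. Qed.

Lemma quotg_mulE x y : quotg_mul (quot_pi x) (quot_pi y) = quot_pi (x * y).
Proof.
apply/quot_piP; move: (quot_repr_pi x) (quot_repr_pi y).
rewrite /quotg_mul.
move: (quot_repr (quot_pi x)) (quot_repr (quot_pi y)) => x' y' hx hy.
have -> : x' * y' * (x * y)^-1 = (y' * y^-1) ^ x'^-1 * (x' * x^-1).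
  by rewrite conjgE invgK invgM !mulgA mulgVK.
by apply: NM => //; apply: NJ.
Qed.

Lemma quotg_invE x : quotg_inv (quot_pi x) = quot_pi x^-1.
Proof.
apply/quot_piP; rewrite invgK; move: (quot_repr_pi x).
move: (quot_repr _) => x' hx.
have -> : x'^-1 * x = ((x' * x^-1)^-1) ^ x'.
  by rewrite conjgE invgM invgK !mulgA mulgVK.
by apply: NJ; apply: NV.
Qed.

Lemma quotg_mulA : associative quotg_mul.
Proof.
move=> a b c; rewrite -(quot_reprK a) -(quot_reprK b) -(quot_reprK c).
by rewrite !quotg_mulE mulgA.
Qed.
Lemma quotg_mul1 : left_id quotg_one quotg_mul.
Proof. by move=> a; rewrite -(quot_reprK a) quotg_mulE mul1g. Qed.
Lemma quotg_mulr1 : right_id quotg_one quotg_mul.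
Proof. by move=> a; rewrite -(quot_reprK a) quotg_mulE mulg1. Qed.
Lemma quotg_mulV : left_inverse quotg_one quotg_inv quotg_mul.
Proof. by move=> a; rewrite -(quot_reprK a) quotg_invE quotg_mulE mulVg. Qed.
Lemma quotg_mulrV : right_inverse quotg_one quotg_inv quotg_mul.
Proof. by move=> a; rewrite -(quot_reprK a) quotg_invE quotg_mulE mulgV. Qed.

HB.instance Definition _ := isGroup.Build quotg
  quotg_mulA quotg_mul1 quotg_mulr1 quotg_mulV quotg_mulrV.

Lemma quot_piM x y : quot_pi (x * y) = quot_pi x * quot_pi y.
Proof. by rewrite -quotg_mulE. Qed.
End QuotientGroup.

Section PGL2.
Variable k : fieldType.
Local Open Scope ring_scope.

Definition GL2 : groupType := units 'M[k]_2.

Definition scalar_pred : {pred GL2} := fun A => is_scalar_mx (val A).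

Lemma scalar_group : group_closed scalar_pred.
Proof.
split=> [|A B /is_scalar_mxP[a defA] /is_scalar_mxP[b defB]];
  apply/is_scalar_mxP.
  by exists 1.
exists (a / b); rewrite /= defA defB; case: (eqVneq b 0) defB => [-> defB|b0 _].
  by have := valP B; rewrite [val B]defB raddf0 unitr0.
by rewrite /GRing.inv /= invmx_scalar -[_ * _]scalar_mxM.
Qed.

Lemma scalar_conj (A B : GL2) : A \in scalar_pred -> (A ^ B)%g \in scalar_pred.
Proof.
move=> /is_scalar_mxP[a defA]; apply/is_scalar_mxP; exists a.
rewrite /conjg /= defA -[_%:M * _]scalar_mxC.
by rewrite [_ * (_ *m _)]mulrA mulVr ?mul1r // (valP B).
Qed.

Definition scalars := NormalSubgroup scalar_group scalar_conj.

Definition PGL2 : groupType := quotg scalars.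

Definition square_pred : {pred units k} :=
  fun x => `[< exists y : units k, x = (y * y)%g >].

Lemma units_fieldC (x y : units k) : (x * y = y * x)%g.
Proof. by apply/val_inj; rewrite /= mulrC. Qed.

Lemma square_group : group_closed square_pred.
Proof.
split=> [|x y /asboolP[u ->] /asboolP[v ->]]; apply/asboolP.
  by exists 1%g; rewrite mulg1.
exists (u * v^-1)%g.
rewrite invgM -[LHS]mulgA -[RHS]mulgA; congr (_ * _)%g.
by rewrite [RHS]mulgA (units_fieldC v^-1%g u) -mulgA.
Qed.

Lemma square_conj (x y : units k) :
  x \in square_pred -> (x ^ y)%g \in square_pred.
Proof. by rewrite conjgE (units_fieldC x) mulgA mulVg mul1g. Qed.

Definition squares := NormalSubgroup square_group square_conj.

Lemma det_unit_subproof (A : GL2) : \det (val A) \is a GRing.unit.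
Proof. by have := valP A; rewrite -[_ \is a _]unitmxE. Qed.

Definition GL2det (A : GL2) : units k := Units (det_unit_subproof A).

Definition detbar (x : PGL2) : quotg squares :=
  quot_pi squares (GL2det (quot_repr x)).

Lemma detbarE (A : GL2) :
  detbar (quot_pi scalars A) = quot_pi squares (GL2det A).
Proof.
apply/quot_piP; have /is_scalar_mxP[c defc] := quot_repr_pi scalars A.
set A' := quot_repr _ in defc *.
have detB : (GL2det A' * (GL2det A)^-1)%g = GL2det (A' * A^-1)%g.
  apply/val_inj; rewrite /= -[val A' * _]/(val A' *m invmx (val A)).
  by rewrite det_mulmx det_inv.
have c0 : c \is a GRing.unit.
  have := det_unit_subproof (A' * A^-1)%g; rewrite defc det_scalar.
  by rewrite unitrX_pos.
apply/asboolP; exists (Units c0); rewrite detB; apply/val_inj.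
by rewrite /= -[X in \det X]/(val (A' * A^-1)%g) defc det_scalar expr2.
Qed.

Lemma detbarM (x y : PGL2) : detbar (x * y)%g = (detbar x * detbar y)%g.
Proof.
rewrite -(quot_reprK x) -(quot_reprK y) -quot_piM !detbarE -quot_piM.
by congr quot_pi; apply/val_inj; rewrite /= -det_mulmx.
Qed.

Definition PSL2 : {pred PGL2} := [pred x | detbar x == 1%g].
End PGL2.
Arguments PSL2 k : clear implicits.

(* A is meant to be (the carrier of) a subgroup of H.                         *)
Definition isomorphic_subgroups (H G : groupType)
    (A : {pred H}) (S : {pred G}) :=
  exists f : H -> G, [/\ {in A &, {morph f : x y / (x * y)%g}},
                         {in A &, injective f}
                       & forall y, y \in S <-> exists2 x, x \in A & y = f x].

Definition contains_subgroup_isog (G H : groupType) (A : {pred H}) :=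
  exists2 S : {pred G}, group_closed S & isomorphic_subgroups A S.

Definition contains_Fq (k : fieldType) (q : nat) :=
  exists2 F : finFieldType, #|F| = q & inhabited {rmorphism F -> k}.

Definition p_semi_elementary (p : nat) (gT : finGroupType) (G : {group gT}) :=
  exists P : {group gT},
    [/\ 'Syl_p(G)%g = [set P], exponent P = p & cyclic (G / P)%g].

(* e is the order of p in (Z/n)^*; this also covers the trivial group n = 1,  *)
(* for which 'Z_n would be Z/2.                                               *)
Definition is_order_mod (n p e : nat) :=
  [/\ (0 < e)%N, p ^ e = 1 %[mod n]
    & forall d : nat, (0 < d)%N -> p ^ d = 1 %[mod n] -> (e <= d)%N].

Definition linearly_independent (K : fieldType) (V : lmodType K) (m : nat)
    (v : 'I_m -> V) :=
  forall c : 'I_m -> K, (\sum_i c i *: v i = 0)%R -> forall i, c i = 0%R.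

(* m <= dim_K V, where dim_K V may be infinite.                               *)
Definition le_dim (m : nat) (K : fieldType) (V : lmodType K) :=
  exists v : 'I_m -> V, linearly_independent v.

(* The dihedral group of order 2n by its presentation, which makes sense for  *)
(* n = 1 too, whereas the library's 'D_(2n) requires n > 1.                   *)
Definition is_dihedral (n : nat) (gT : finGroupType) (G : {group gT}) :=
  (G \isog Grp (x : y : x ^+ n, y ^+ 2, x ^ y = x^-1))%g.

Definition separable_closure (k ks : fieldType) (iota : {rmorphism k -> ks}) :=
  (forall x : ks, exists2 f : {poly k},
     separable_poly f & root (map_poly iota f) x) /\
  (forall f : {poly ks},
     separable_poly f -> (1 < size f)%N -> exists x, root f x).

(* Main.v *)
Require Import Defs.
From HB Require Import structures.
From mathcomp Require Import all_boot all_order all_fingroup all_algebra.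
From mathcomp Require Import all_solvable all_field mxabelem boolp.
From mathcomp Require Import ring zify.

(* Parts (1) and (2) rest on one structure result for a finite subgroup [G]   *)
(* of [PGL2 k] with a normal Sylow [p]-subgroup [P] of exponent [p]. A lift   *)
(* of a central element of [P] is [s + N] with [N] nilpotent, and conjugation *)
(* rescales [N]: this gives a character [chi] of [G] with kernel [P] and an   *)
(* embedding [tau] of [P] into the additive group of [k] with                 *)
(* [tau (x ^ g) = chi g * tau x]. Hence [chi] maps a generator of [G / P] to  *)
(* a primitive [n]-th root of unity of [k], and multiplying the nonzero       *)
(* values of [tau] by it permutes them, so [n] divides [p ^ m - 1]. The only  *)
(* other possibility is that [p = 2] and the lift generates an inseparable    *)
(* quadratic extension; then [G = P] and [k] is infinite. The upper           *)
(* triangular subgroup of [PSL2 Fq] falls under this analysis, and the order  *)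
(* of [p] modulo the number of squares of [Fq^*] is [r].                      *)
(* For (3) and (4), an element of [PGL2 k] with lift [A] of trace [T] and     *)
(* determinant [D] has finite order read off from [T ^ 2 / D]: in             *)
(* characteristic 2 this is [zeta + zeta^-1] with [zeta] of that order, and   *)
(* in characteristic 3 order 5 forces [(T ^ 2 / D) ^ 2 = -1].                 *)

Set Implicit Arguments.
Unset Strict Implicit.
Unset Printing Implicit Defensive.

Import GRing.Theory.
Local Open Scope ring_scope.

(** * Lifts to two by two matrices *)

(** Containment is treated as the existence of an injective multiplicative map, computed on matrix
    lifts modulo scalars. Besides the structure result sketched above, the proof rests on one
    field-theoretic fact and on explicit constructions. If [p] has order [e] modulo [n], a primitive
    [n]-th root of unity in [k] generates a field of [p ^ e] elements ([finField_rmorphism]); this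
    yields every inclusion of a finite field in [k], including [F_9] from a primitive fourth root of
    unity. Conversely, for (2) let [F] be the subfield of [p ^ e] elements. The bound on the
    dimension leaves room for an [F]-subspace of [k] of dimension [m / e], and the matrices
    [[a v; 0 1]], with [v] in it and [a] an [n]-th root of unity of [F], form the subgroup
    ([semi_elementary_exists]). For (1), scalars are extended from [Fq] to [k]. For (3), the swap of
    coordinates and the companion matrix of [X^2 - c X + 1], with [c = zeta + zeta^-1], generate the
    dihedral group ([dihedral_root_sub]). For (4), a square root of [-1] gives explicit matrices for
    the sixty even permutations, checked by computation ([alt5_sub]). *)

Lemma contains_subgroup_isogP (G H : groupType) (A : {pred H}) :
  group_closed A ->
  contains_subgroup_isog G A <->
  exists f : H -> G, {in A &, {morph f : x y / (x * y)%g}} /\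
                     {in A &, injective f}.
Proof.
move=> [A1 AD]; split=> [[S _ [f [fM fI _]]]|[f [fM fI]]]; first by exists f.
have f1 : f 1%g = 1%g.
  by apply: (mulgI (f 1%g)); rewrite -fM // !mulg1.
have AV x : x \in A -> (x^-1)%g \in A.
  by move=> Ax; rewrite -[(x^-1)%g]mul1g AD.
have fV x : x \in A -> f (x^-1)%g = ((f x)^-1)%g.
  move=> Ax; apply: (mulgI (f x)).
  by rewrite -fM ?AV // !mulgV f1.
pose S : {pred G} := fun y => `[< exists2 x, x \in A & y = f x >].
exists S; last first.
  by exists f; split=> // y; split=> [/asboolP|yS]; last apply/asboolP.
split=> [|_ _ /asboolP[x Ax ->] /asboolP[y Ay ->]]; apply/asboolP.
  by exists 1%g.
by exists (x * y^-1)%g; rewrite ?AD // fM ?fV ?AV.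
Qed.

Lemma closed_morph_inj (G H : groupType) (A : {pred H}) (f : H -> G) :
  group_closed A -> {in A &, {morph f : x y / (x * y)%g}} ->
  {in A, forall x, f x = 1%g -> x = 1%g} -> {in A &, injective f}.
Proof.
move=> [A1 AD] fM ker x y Ax Ay e.
have Axy : (x * y^-1)%g \in A by apply: AD.
rewrite -[x](mulgVK y) -[RHS]mul1g; congr (_ * _)%g; apply: ker => //.
by apply: (mulIg (f y)); rewrite -fM // mulgVK mul1g.
Qed.

Lemma group_closed_fingroup (gT : finGroupType) (G : {group gT}) :
  group_closed (G : {pred gT}).
Proof. by split=> [|x y Gx Gy]; rewrite ?group1 ?groupM ?groupV. Qed.

Lemma primitive_rootP (R : nzRingType) (n : nat) (z : R) : (0 < n)%N ->
  (forall j, (z ^+ j == 1) = (n %| j)%N) -> n.-primitive_root z.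
Proof.
move=> n0 zn; rewrite /primitive_root_of_unity n0 /=; apply/forallP=> i.
rewrite unity_rootE zn; apply/eqP; apply/idP/idP => [dv|/eqP->//].
by rewrite eqn_leq (dvdn_leq _ dv) // ltn_ord.
Qed.

Section Mx2.
Variable K : fieldType.
Implicit Types A B N : 'M[K]_2.

Definition mx2 (a b c d : K) : 'M[K]_2 :=
  \matrix_(i, j) if i == 0 then if j == 0 then a else b
                 else if j == 0 then c else d.

Lemma mx2_eta A : A = mx2 (A 0 0) (A 0 1) (A 1 0) (A 1 1).
Proof.
by apply/matrixP=> [[[|[|[]]] // i] [[|[|[]]] // j]]; rewrite mxE /=;
  congr (A _ _); apply/val_inj.
Qed.

Lemma mx2_inj a b c d a' b' c' d' : mx2 a b c d = mx2 a' b' c' d' ->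
  [/\ a = a', b = b', c = c' & d = d'].
Proof.
by move/matrixP=> e; have := (e 0 0, e 0 1, e 1 0, e 1 1); rewrite !mxE /=;
  case=> [[[]]].
Qed.

Lemma mx2M a b c d a' b' c' d' : mx2 a b c d * mx2 a' b' c' d' =
  mx2 (a * a' + b * c') (a * b' + b * d') (c * a' + d * c') (c * b' + d * d').
Proof.
by apply/matrixP=> [[[|[|[]]] // i] [[|[|[]]] // j]];
  rewrite !mxE /= !big_ord_recl big_ord0 !mxE /= addr0.
Qed.

Lemma mx2D a b c d a' b' c' d' : mx2 a b c d + mx2 a' b' c' d' =
  mx2 (a + a') (b + b') (c + c') (d + d').
Proof.
by apply/matrixP=> [[[|[|[]]] // i] [[|[|[]]] // j]]; rewrite !mxE.
Qed.

Lemma mx2Z x a b c d : x *: mx2 a b c d = mx2 (x * a) (x * b) (x * c) (x * d).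
Proof.
by apply/matrixP=> [[[|[|[]]] // i] [[|[|[]]] // j]]; rewrite !mxE.
Qed.

Lemma mx2_scalar x : x%:M = mx2 x 0 0 x.
Proof.
by apply/matrixP=> [[[|[|[]]] // i] [[|[|[]]] // j]]; rewrite !mxE.
Qed.

Lemma det_mx2 a b c d : \det (mx2 a b c d) = a * d - b * c.
Proof.
rewrite (expand_det_row _ 0) !big_ord_recl big_ord0 /cofactor !det_mx11 !mxE /=.
by rewrite expr0 expr1; ring.
Qed.

Lemma unit_mx2E A : (A \is a GRing.unit) = (\det A != 0).
Proof. by rewrite -unitfE -unitmxE. Qed.

Lemma tr_mx2 a b c d : \tr (mx2 a b c d) = a + d.
Proof. by rewrite /mxtrace !big_ord_recl big_ord0 !mxE /= addr0. Qed.

Lemma Cayley_Hamilton2 A : A ^+ 2 = \tr A *: A - (\det A)%:M.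
Proof.
rewrite expr2 (mx2_eta A) tr_mx2 det_mx2 -scaleN1r mx2M mx2_scalar !mx2Z mx2D.
by congr mx2; ring.
Qed.

Lemma mx2_scalarP a b c d :
  reflect [/\ a = d, b = 0 & c = 0] (is_scalar_mx (mx2 a b c d)).
Proof.
apply: (iffP is_scalar_mxP) => [[x]|[-> -> ->]].
  by rewrite mx2_scalar => /mx2_inj[-> -> -> ->].
by exists d; rewrite mx2_scalar.
Qed.

(** Modulo scalars a matrix is the vector [(b, c, a - d)]. Commuting means that the cross product of
    two such vectors vanishes, and the vector of [A] is nonzero, so that of [B] is a multiple of
    it. *)
Lemma commutant2 A B : ~~ is_scalar_mx A -> B * A = A * B ->
  exists x y, B = x%:M + y *: A.
Proof.
rewrite (mx2_eta A) (mx2_eta B).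
move: (A 0 0) (A 0 1) (A 1 0) (A 1 1) => a b c d.
move: (B 0 0) (B 0 1) (B 1 0) (B 1 1) => a' b' c' d' nsA.
rewrite !mx2M => /mx2_inj[e1 e2 e3 e4].
suff [y [-> -> ey]] : exists y, [/\ b' = y * b, c' = y * c & a' - d' = y * (a - d)].
  exists (a' - y * a), y; rewrite mx2_scalar mx2Z mx2D; congr mx2; try ring.
  by rewrite -[LHS](subKr a') ey; ring.
have e1' : b * c' = b' * c by apply: (addrI (a' * a)); rewrite [RHS]e1; ring.
have e2' : b * (a' - d') = b' * (a - d).
  rewrite [LHS](_ : _ = a' * b + b' * d - b' * d - b * d'); last by ring.
  by rewrite e2; ring.
have e3' : c * (a' - d') = c' * (a - d).
  rewrite [RHS](_ : _ = c' * a + d' * c - c' * d - d' * c); last by ring.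
  by rewrite e3; ring.
have [b0|b0] := eqVneq b 0; last first.
  by exists (b' / b); split; apply: (mulfI b0); rewrite ?e1' ?e2'; field.
have [c0|c0] := eqVneq c 0; last first.
  exists (c' / c); split; apply: (mulfI c0); rewrite ?e3'; try field => //.
  by rewrite mulrC -e1'; field.
have ad : a - d != 0.
  apply: contraNneq nsA => /subr0_eq ead; apply/mx2_scalarP; split=> //.
exists ((a' - d') / (a - d)); split; last by field.
  by apply: (mulIf ad); rewrite -e2' b0; ring.
by apply: (mulIf ad); rewrite -e3' c0; ring.
Qed.

Lemma mul_scalar_mx2 c A : c%:M * A = c *: A.
Proof. exact: mul_scalar_mx. Qed.

Lemma scalar_mx2C c A : A * c%:M = c *: A.
Proof. exact: mul_mx_scalar. Qed.

Lemma scalar_add_nilp N (x y : K) : N ^+ 2 = 0 -> N != 0 ->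
  (x%:M + y *: N) ^+ 2 = 0 -> x = 0.
Proof.
move=> N2 N0 /(congr1 (fun X => X * N)); rewrite mul0r expr2 -mulrA.
have -> : (x%:M + y *: N) * N = x *: N.
  by rewrite mulrDl mul_scalar_mx2 -scalerAl -expr2 N2 scaler0 addr0.
rewrite -scalerAr mulrDl mul_scalar_mx2 -scalerAl -expr2 N2 scaler0 addr0.
move/eqP; rewrite scalerA scaler_eq0 (negPf N0) orbF mulf_eq0 orbb.
by move/eqP.
Qed.
End Mx2.

Section PGL.
Variable k : fieldType.
Implicit Types (A B : 'M[k]_2) (x y : PGL2 k).

(** A singular matrix is sent to the identity by default. *)
Definition pgl A : PGL2 k := quot_pi (scalars k) (insubd (1%g : GL2 k) A).
Definition pgl_lift x : 'M[k]_2 := val (quot_repr x).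

Lemma pgl_lift_unit x : pgl_lift x \is a GRing.unit.
Proof. exact: valP (quot_repr x). Qed.

Lemma pgl_liftK x : pgl (pgl_lift x) = x.
Proof. by rewrite /pgl /pgl_lift valKd quot_reprK. Qed.

Lemma pglM A B : A \is a GRing.unit -> B \is a GRing.unit ->
  pgl (A * B) = (pgl A * pgl B)%g.
Proof.
move=> uA uB; rewrite /pgl -quot_piM; congr quot_pi; apply/val_inj.
by rewrite /= !val_insubd unitrMl // uA uB.
Qed.

Lemma pgl1 : pgl 1 = 1%g.
Proof. by congr quot_pi; apply/val_inj; rewrite val_insubd unitr1. Qed.

Lemma pglX A n : A \is a GRing.unit -> pgl (A ^+ n) = (pgl A ^+ n)%g.
Proof.
move=> uA; elim: n => [|n IHn]; first by rewrite expr0 expg0 pgl1.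
by rewrite exprS expgS pglM ?unitrX // IHn.
Qed.

Lemma pglP A B : A \is a GRing.unit -> B \is a GRing.unit ->
  pgl A = pgl B <-> exists2 c, c != 0 & A = c *: B.
Proof.
move=> uA uB; rewrite /pgl.
have vA : val (insubd (1%g : GL2 k) A) = A by rewrite val_insubd uA.
have vB : val (insubd (1%g : GL2 k) B) = B by rewrite val_insubd uB.
split=> [/quot_piP/is_scalar_mxP[c]|[c c0 eA]].
  rewrite -[val _]/(val (insubd (1%g : GL2 k) A) * (val (insubd (1%g : GL2 k) B))^-1).
  rewrite vA vB => /(congr1 (fun X => X * B)).
  rewrite mulrVK // mul_scalar_mx2 => eA; exists c => //.
  by apply: contraTneq uA => c0; rewrite eA c0 scale0r unitr0.
apply/quot_piP/is_scalar_mxP; exists c.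
rewrite -[LHS]/(val (insubd (1%g : GL2 k) A) * (val (insubd (1%g : GL2 k) B))^-1).
by rewrite vA vB eA -scalerAl divrr // -scalemx1.
Qed.

Lemma pgl_eq1 A : A \is a GRing.unit -> pgl A = 1%g <-> is_scalar_mx A.
Proof.
move=> uA; rewrite -pgl1 pglP ?unitr1 //; split=> [[c _ ->]|].
  by rewrite scalemx1 scalar_mx_is_scalar.
case/is_scalar_mxP=> c eA; exists c; last by rewrite scalemx1.
by apply: contraTneq uA => c0; rewrite eA c0 raddf0 unitr0.
Qed.

Lemma pgl_liftM x y :
  exists2 c, c != 0 & pgl_lift (x * y)%g = c *: (pgl_lift x * pgl_lift y).
Proof.
apply/pglP; rewrite ?unitrMl ?pgl_lift_unit //.
by rewrite pglM ?pgl_lift_unit // !pgl_liftK.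
Qed.

Lemma pgl_liftX x n : pgl (pgl_lift x ^+ n) = (x ^+ n)%g.
Proof. by rewrite pglX ?pgl_lift_unit // pgl_liftK. Qed.

Lemma pgl_lift_scalar x : is_scalar_mx (pgl_lift x) -> x = 1%g.
Proof. by rewrite -pgl_eq1 ?pgl_lift_unit // pgl_liftK. Qed.
End PGL.

(** * Subgroups with a normal Sylow subgroup of exponent p *)

Section PElements.
Variables (k : fieldType) (p : nat).
Hypothesis charkp : p \in [pchar k].
Implicit Types A B N : 'M[k]_2.

Lemma scale_is_scalar_mx A a c : a != 0 -> a *: A = c%:M -> is_scalar_mx A.
Proof.
move=> a0 e; apply/is_scalar_mxP; exists (a^-1 * c).
by rewrite -[A](scalerK a0) e scale_scalar_mx.
Qed.

Lemma scalar_addr_scalar_mx A c : is_scalar_mx (A - c%:M) -> is_scalar_mx A.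
Proof.
case/is_scalar_mxP=> d e; apply/is_scalar_mxP; exists (d + c).
by rewrite raddfD /= -e subrK.
Qed.

Lemma expr2_sub_scalar A s :
  (A - s%:M) ^+ 2 = (\tr A - s *+ 2) *: A + (s ^+ 2 - \det A)%:M.
Proof.
have -> : (A - s%:M) ^+ 2 = A ^+ 2 - (s *+ 2) *: A + (s ^+ 2)%:M.
  rewrite expr2 mulrBr !mulrBl scalar_mx2C mul_scalar_mx2 -expr2 opprB.
  rewrite -[s%:M * _]scalar_mxM -expr2 mulr2n scalerDl opprD !addrA.
  by rewrite addrAC -!addrA; congr (_ + _); rewrite addrC -addrA.
rewrite Cayley_Hamilton2 scalerBl raddfB /= -!addrA; congr (_ + _).
by rewrite addrC -!addrA; congr (_ + _); rewrite addrC.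
Qed.

(* Over a perfect field an element of order [p] is unipotent; the second case *)
(* is an involution whose fixed point on the projective line is purely        *)
(* inseparable.                                                               *)
Lemma order_p_lift A : A \is a GRing.unit -> ~~ is_scalar_mx A ->
    is_scalar_mx (A ^+ p) ->
  (exists (s : k) N, [/\ s != 0, N != 0, N ^+ 2 = 0 & A = s%:M + N])
  \/ [/\ p = 2%N, A ^+ 2 = (\det A)%:M & forall s : k, s ^+ 2 != \det A].
Proof.
move=> uA nsA scAp; have det0 : \det A != 0 by rewrite -unitfE -[_ \is a _]unitmxE.
have nilp_split s : \tr A = s *+ 2 -> s ^+ 2 = \det A ->
    exists (s : k) N, [/\ s != 0, N != 0, N ^+ 2 = 0 & A = s%:M + N].
  move=> trA detA; exists s, (A - s%:M); split.
  - by apply: contraNneq det0 => s0; rewrite -detA s0 expr0n.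
  - apply: contraNneq nsA => /subr0_eq->; exact: scalar_mx_is_scalar.
  - by rewrite expr2_sub_scalar trA detA !subrr scale0r raddf0 addr0.
  - by rewrite addrC subrK.
have [p2|podd] := eqVneq p 2%N.
  have two0 (x : k) : x *+ 2 = 0 by rewrite -mulr_natr -p2 pcharf0 ?mulr0.
  case/is_scalar_mxP: scAp => c; rewrite p2 Cayley_Hamilton2 => eA.
  have trA : \tr A = 0.
    apply/eqP; apply: contraNT nsA => tr0.
    apply: (@scale_is_scalar_mx A (\tr A) (c + \det A)) => //.
    by rewrite raddfD /= -eA subrK.
  have [[s es]|ns] := pselect (exists s, s ^+ 2 = \det A).
    by left; apply: (nilp_split s); rewrite ?two0.
  right; split=> // [|s]; last by apply/eqP=> es; apply: ns; exists s.
  rewrite trA scale0r add0r -raddfN /=; congr _%:M.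
  by apply/esym/eqP; rewrite -addr_eq0 -mulr2n two0.
left; have p_pr := pcharf_prime charkp.
have odd_p : odd p by case: (even_prime p_pr) podd => // ->.
have two0 : 2%:R != 0 :> k.
  by rewrite -(dvdn_pcharf charkp) (dvdn_prime2 p_pr).
pose s := \tr A / 2%:R.
have trA : \tr A = s *+ 2 by rewrite -mulr_natr divfK.
apply: (nilp_split s) => //; apply/eqP; rewrite -subr_eq0.
(* If [d = s ^ 2 - \det A] were nonzero, [(A - s) ^ p] would be both a scalar, by Frobenius, and
   [d ^ ((p - 1) / 2)] times [A - s], so [A] would be scalar. *)
apply: contraNT nsA => d0; apply: (@scalar_addr_scalar_mx _ s).
have N2 : (A - s%:M) ^+ 2 = (s ^+ 2 - \det A)%:M.
  by rewrite expr2_sub_scalar trA subrr scale0r add0r.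
case/is_scalar_mxP: scAp => c eA.
have charMp : p \in [pchar 'M[k]_2] by rewrite pchar_lalg.
have Np : (A - s%:M) ^+ p = (c - s ^+ p)%:M.
  have := pFrobenius_autB_comm charMp (x := A) (y := s%:M) (scalar_mxC s A).
  by rewrite !pFrobenius_autE eA => ->; rewrite raddfB /= rmorphXn.
apply: (@scale_is_scalar_mx _ ((s ^+ 2 - \det A) ^+ p./2) (c - s ^+ p)).
  by rewrite expf_neq0.
rewrite -Np -[in RHS](odd_double_half p) odd_p add1n -mul2n [RHS]exprS exprM N2.
by rewrite -rmorphXn /= scalar_mx2C.
Qed.
End PElements.

Lemma det_mx2M (k : fieldType) (A B : 'M[k]_2) :
  \det (A * B) = \det A * \det B.
Proof. exact: det_mulmx. Qed.

Section Nilpotent.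
Variables (k : fieldType) (N : 'M[k]_2).
Hypotheses (N2 : N ^+ 2 = 0) (N0 : N != 0).
Implicit Types X : 'M[k]_2.

Lemma nilp_not_scalar : ~~ is_scalar_mx N.
Proof.
apply/negP=> /is_scalar_mxP[c eN]; have c0 : c = 0.
  apply: (@scalar_add_nilp _ N c 0 N2 N0).
  by rewrite scale0r addr0 -eN.
by move: N0; rewrite eN c0 raddf0 eqxx.
Qed.

(** The conjugate [a + b N] of [N] is again nilpotent, so its scalar part vanishes. *)
Lemma nilp_conj X (a b : k) : X \is a GRing.unit ->
  N * X = X * (a%:M + b *: N) -> a = 0 /\ N * X = b *: (X * N).
Proof.
move=> uX eX; have a0 : a = 0.
  apply: (@scalar_add_nilp _ N a b N2 N0); apply: (mulrI uX).
  by rewrite mulr0 expr2 mulrA -eX -mulrA -eX mulrA -expr2 N2 mul0r.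
by rewrite eX a0 raddf0 add0r scalerAr.
Qed.

Lemma mulr_scalar_addZ X (a b : k) :
  X * (a%:M + b *: N) = a *: X + b *: (X * N).
Proof. by rewrite mulrDr scalar_mx2C scalerAr. Qed.

Lemma unipotentM (t u : k) : (1 + t *: N) * (1 + u *: N) = 1 + (t + u) *: N.
Proof.
rewrite mulrDr mulr1 -scalerAr mulrDl mul1r -scalerAl -expr2 N2 scaler0 addr0.
by rewrite -addrA -scalerDl.
Qed.

(** The parameter of a unipotent matrix survives in [PGL2 k]; this makes [tau] in [borel_structure]
    well defined. *)
Lemma unipotent_inj (a b t u : k) : a != 0 ->
  a *: (1 + t *: N) = b *: (1 + u *: N) -> t = u.
Proof.
move=> a0 /eqP; rewrite -subr_eq0 !scalerDr !scalerA opprD addrACA -scalerBl.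
rewrite -[X in _ + X]scalerBl scalemx1 => /eqP e.
have /eqP/subr0_eq ab : a - b == 0.
  apply/eqP; apply: (@scalar_add_nilp _ N _ (a * t - b * u) N2 N0).
  by rewrite e expr0n.
move/eqP: e; rewrite -ab subrr raddf0 add0r scaler_eq0 (negPf N0) orbF.
by rewrite -mulrBr mulf_eq0 (negPf a0) subr_eq0 => /eqP.
Qed.

(** The commutant is the local ring [k[N]], whose units have a nonzero scalar part. *)
Lemma commutant_nilp X : X \is a GRing.unit -> X * N = N * X ->
  exists a t : k, a != 0 /\ X = a *: (1 + t *: N).
Proof.
move=> uX /(commutant2 nilp_not_scalar)[a [b eX]].
have a0 : a != 0.
  apply: contraTneq uX => a0; rewrite eX a0 raddf0 add0r.
  apply/negP => ubN; have := unitrX 2 ubN.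
  by rewrite exprZn N2 scaler0 unitr0.
by exists a, (b / a); rewrite scalerDr scalerA mulrC divfK // scalemx1.
Qed.

Lemma unipotentXp p (t : k) : p \in [pchar k] -> (1 + t *: N) ^+ p = 1.
Proof.
move=> charkp; have charMp : p \in [pchar 'M[k]_2] by rewrite pchar_lalg.
have := pFrobenius_autD_comm charMp (x := 1) (y := t *: N) (commr_sym (commr1 _)).
rewrite !pFrobenius_autE expr1n => ->; rewrite exprZn.
have /subnK <- := prime_gt1 (pcharf_prime charkp).
by rewrite [N ^+ _]exprD N2 mulr0 scaler0 addr0.
Qed.
End Nilpotent.

Section Structure.
Variables (k : fieldType) (p : nat).
Hypothesis charkp : p \in [pchar k].
Variables (gT : finGroupType) (G P : {group gT}) (f : gT -> PGL2 k).
Hypothesis fM : {in G &, {morph f : x y / (x * y)%g}}.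
Hypothesis fI : {in G &, injective f}.

Let M g := pgl_lift (f g).

Lemma morph_pgl1 : f 1%g = 1%g.
Proof. by apply: (mulgI (f 1%g)); rewrite -fM // !mulg1. Qed.

Lemma morph_pglX x n : x \in G -> f (x ^+ n)%g = (f x ^+ n)%g.
Proof.
move=> Gx; elim: n => [|n IHn]; first by rewrite !expg0 morph_pgl1.
by rewrite !expgS fM ?groupX // IHn.
Qed.

Lemma lift_scalarX x n : x \in G -> is_scalar_mx (M x ^+ n) <-> (x ^+ n = 1)%g.
Proof.
move=> Gx; rewrite -pgl_eq1 ?unitrX ?pgl_lift_unit // pgl_liftX -morph_pglX //.
split=> [|->]; last exact: morph_pgl1.
by rewrite -morph_pgl1; apply: fI => //; rewrite groupX.
Qed.

Lemma lift_scalar x : x \in G -> is_scalar_mx (M x) -> x = 1%g.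
Proof. by move=> Gx; have := lift_scalarX 1 Gx; rewrite expr1 expg1 => ->. Qed.

Lemma lift_conj x g : x \in G -> g \in G ->
  exists2 c, c != 0 & M x * M g = c *: (M g * M (x ^ g)%g).
Proof.
move=> Gx Gg; have Gxg : (x ^ g)%g \in G by rewrite groupJ.
apply/pglP; rewrite ?unitrMl ?pgl_lift_unit //.
by rewrite !pglM ?pgl_lift_unit // !pgl_liftK -!fM // -conjgC.
Qed.

Hypotheses (sylP : (p.-Sylow(G) P)%g) (nPG : (P <| G)%g) (expP : exponent P = p).

(* [chi] is the ratio of the diagonal entries in a basis adapted to the line  *)
(* fixed by [P], and [tau] the off-diagonal entry of the elements of [P].     *)
Lemma borel_structure :
  (exists (chi tau : gT -> k),
    [/\ {in G &, {morph chi : x y / (x * y)%g >-> x * y}},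
        {in G, forall g, (chi g == 1) = (g \in P)},
        {in P &, {morph tau : x y / (x * y)%g >-> x + y}},
        {in P, forall x, tau x = 0 -> x = 1%g}
      & {in P & G, forall x g, tau (x ^ g)%g = chi g * tau x}])
  \/ [/\ p = 2%N, G = P & exists d : k, forall s, s ^+ 2 != d].
Proof.
have p_pr := pcharf_prime charkp.
have [sPG pP] : P \subset G /\ (p.-group P)%g.
  by split; [apply: normal_sub | apply: pHall_pgroup sylP].
have GP := subsetP sPG.
have ntP : P != 1%G.
  by apply: contraTneq p_pr => P1; rewrite -expP P1 exponent1.
have /trivgPn[z Zz nz1] : ('Z(P) != 1)%g.
  by apply: contraNneq ntP => /(trivg_center_pgroup pP) P1; apply/eqP/val_inj.
have /centerP[Pz cPz] := Zz; have Gz := GP z Pz.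
have zp : (z ^+ p = 1)%g by rewrite -expP expg_exponent.
have mem_P g : g \in G -> (g ^+ p = 1)%g -> g \in P.
  move=> Gg gp; rewrite (mem_normal_Hall sylP nPG Gg) /p_elt.
  apply: (@pnat_dvd _ p); rewrite ?pnat_id // order_dvdn gp //.
have uM x : M x \is a GRing.unit by apply: pgl_lift_unit.
have nsA : ~~ is_scalar_mx (M z) by apply: contraNN nz1 => /lift_scalar->.
have scAp : is_scalar_mx (M z ^+ p) by apply/lift_scalarX.
have [[s [N [s0 N0 N2 eA]]]|[p2 A2 nsq]] := order_p_lift charkp (uM z) nsA scAp.
  left.
  (* In [PGL2 k] the lifts of [z] and [x] commute only up to a factor [c]. The scalar part
     [(c - 1) s] of the conjugate of [N] must vanish, hence [c = 1]. *)
  have cNP x : x \in P -> M x * N = N * M x.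
    move=> Px; have [c c0] := lift_conj Gz (GP x Px).
    have -> : (z ^ x)%g = z by apply/conjg_fixP/commgP/cPz.
    rewrite eA mulrDl mul_scalar_mx2 => e.
    have {}e : N * M x = M x * ((c * s - s)%:M + c *: N).
      apply: (addrI (s *: M x)); rewrite e !mulr_scalar_addZ addrA -scalerDl.
      by rewrite [s + _]addrC subrK mulrDr scalar_mx2C scalerDr scalerA.
    have [/eqP] := nilp_conj N2 N0 (uM x) e.
    rewrite -[X in _ - X]mul1r -mulrBl mulf_eq0 (negPf s0) orbF subr_eq0.
    by move/eqP=> -> ->; rewrite scale1r.
  have tauP x : exists t, x \in P -> exists2 a, a != 0 & M x = a *: (1 + t *: N).
    have [Px|] := boolP (x \in P); last by exists 0.
    have [a [t [a0 e]]] := commutant_nilp N2 N0 (uM x) (cNP x Px).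
    by exists t => _; exists a.
  have [tau {}tauP] := choice tauP.
  have tau_uniq x a t : x \in P -> M x = a *: (1 + t *: N) -> tau x = t.
    by move=> Px; have [b b0 ->] := tauP x Px; apply: unipotent_inj.
  (* As [z ^ g] lies in [P], its lift is in [k[N]]; so [M g] conjugates [N] into [k[N]], hence to a
     multiple of [N]. *)
  have chiP g : exists y, g \in G -> N * M g = y *: (M g * N).
    have [Gg|] := boolP (g \in G); last by exists 0.
    have [c c0] := lift_conj Gz Gg.
    have Pzg : (z ^ g)%g \in P by rewrite memJ_norm // (subsetP (normal_norm nPG)).
    have [a a0 ->] := tauP _ Pzg; move: (tau _) => t.
    rewrite eA mulrDl mul_scalar_mx2 => e.
    have {}e : N * M g = M g * ((c * a - s)%:M + (c * a * t) *: N).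
      apply: (addrI (s *: M g)); rewrite e !mulr_scalar_addZ addrA -scalerDl.
      rewrite [s + _]addrC subrK scalerAr scalerA scalerDr scalerA scalemx1.
      by rewrite mulr_scalar_addZ.
    by have [_ ->] := nilp_conj N2 N0 (uM g) e; exists (c * a * t).
  have [chi {}chiP] := choice chiP.
  have MN0 g : M g * N != 0 by rewrite mulrI_eq0 //; apply: mulrI.
  have chi_uniq g y : g \in G -> N * M g = y *: (M g * N) -> chi g = y.
    move=> Gg; rewrite chiP // => /eqP.
    by rewrite -subr_eq0 -scalerBl scaler_eq0 (negPf (MN0 g)) orbF subr_eq0 => /eqP.
  exists chi, tau; split.
  - move=> g h Gg Gh; apply: chi_uniq; rewrite ?groupM // /M fM //.
    have [c c0 ->] := pgl_liftM (f g) (f h); rewrite -!/(M _).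
    rewrite -scalerAl -scalerAr mulrA chiP // -scalerAl -mulrA chiP //.
    rewrite -!scalerAr !scalerA !mulrA.
    by congr (_ *: _); ring.
  (* If [chi g = 1], the lift of [g] commutes with [N], so it is a scalar times a unipotent and
     [g ^ p = 1]. *)
  - move=> g Gg; apply/eqP/idP => [chi1|Pg]; last first.
      by apply: chi_uniq => //; rewrite scale1r cNP.
    apply: mem_P => //; apply/lift_scalarX => //.
    have eg : M g * N = N * M g by rewrite chiP // chi1 scale1r.
    have [a [t [a0 ->]]] := commutant_nilp N2 N0 (uM g) eg.
    by rewrite exprZn unipotentXp // scalemx1 scalar_mx_is_scalar.
  - move=> x y Px Py; have [a a0 ex] := tauP x Px; have [b b0 ey] := tauP y Py.
    have [c c0] := pgl_liftM (f x) (f y); rewrite -!/(M _) -fM ?GP // ex ey.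
    rewrite -scalerAl -scalerAr unipotentM // !scalerA.
    by apply: tau_uniq; rewrite groupM.
  - move=> x Px t0; have [a a0] := tauP x Px.
    rewrite t0 scale0r addr0 scalemx1 => e; apply: lift_scalar; first exact: GP.
    by rewrite e scalar_mx_is_scalar.
  move=> x g Px Gg; have [c c0] := lift_conj (GP x Px) Gg.
  have Pxg : (x ^ g)%g \in P by rewrite memJ_norm // (subsetP (normal_norm nPG)).
  have [a a0 ->] := tauP x Px; have [b b0 ->] := tauP _ Pxg => e.
  apply/esym; apply: (@unipotent_inj _ N N2 N0 a (c * b)) => //.
  apply: (mulrI (uM g)).
  rewrite -[in RHS]scalerA -[in RHS]scalerAr -e -scalerAr -scalerAl.
  rewrite mulrDl mulrDr mul1r mulr1 -scalerAl chiP // -scalerAr scalerA.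
  by rewrite mulrC.
right; split=> //; last by exists (\det (M z)).
have two0 (x : k) : x *+ 2 = 0 by rewrite -mulr_natr -p2 pcharf0 ?mulr0.
have opp_id (x : k) : - x = x by apply/eqP; rewrite eq_sym -addr_eq0 -mulr2n two0.
have sqr_eq1 (c : k) : c ^+ 2 = 1 -> c = 1.
  by move/eqP; rewrite sqrf_eq1 opp_id orbb => /eqP.
have det0 x : \det (M x) != 0 by rewrite -unitfE -[_ \is a _]unitmxE.
have polyA x : x \in P -> exists a b, M x = a%:M + b *: M z.
  move=> Px; have [c c0] := lift_conj Gz (GP x Px).
  have -> : (z ^ x)%g = z by apply/conjg_fixP/commgP/cPz.
  move=> e; apply: (commutant2 nsA).
  have c1 : c = 1.
    apply: sqr_eq1; apply: (mulIf (mulf_neq0 (det0 x) (det0 z))).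
    by rewrite mul1r -det_mx2M -detZ -e !det_mx2M mulrC.
  by rewrite e c1 scale1r.
(* Conjugation by [g] turns [M z] into [a + b * M z], up to the side chosen. Squaring gives
   [(1 - b) ^ 2 * \det (M z) = a ^ 2]; the determinant is not a square, so [b = 1] and [a = 0].
   Hence [M g] lies in [k[M z]], where all squares are scalars. *)
have G2 g : g \in G -> (g ^+ 2 = 1)%g.
  move=> Gg; apply/lift_scalarX => //.
  have [c c0] := lift_conj Gz Gg.
  have Pzg : (z ^ g)%g \in P by rewrite memJ_norm // (subsetP (normal_norm nPG)).
  have [a [b ->]] := polyA _ Pzg; rewrite scalerAr scalerDr scale_scalar_mx scalerA.
  move: (c * a) (c * b) => {a b c c0} a b e.
  have sqr_poly u v : (u%:M + v *: M z) ^+ 2 = (u ^+ 2 + v ^+ 2 * \det (M z))%:M.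
    rewrite expr2 mulrDl mul_scalar_mx2 scalerDr mulrDr -!scalerAl scalar_mx2C.
    rewrite -scalerAr -expr2 A2 !scalerA !scale_scalar_mx addrACA.
    rewrite -!expr2 [v * u]mulrC -addrA (addrA (_ *: _)) -scalerDl -mulr2n.
    by rewrite two0 scale0r add0r raddfD.
  have edet : \det (M z) = a ^+ 2 + b ^+ 2 * \det (M z).
    apply/eqP; rewrite -subr_eq0.
    have /eqP : (\det (M z) - (a ^+ 2 + b ^+ 2 * \det (M z))) *: M g = 0.
      rewrite scalerBl -mul_scalar_mx2 -A2 -scalar_mx2C -sqr_poly !expr2.
      by rewrite -(mulrA (M z)) e (mulrA (M z)) e -mulrA subrr.
    rewrite scaler_eq0 => /orP[//|/eqP Mg0].
    by have := uM g; rewrite Mg0 unitr0.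
  have [b1|b1] := eqVneq b 1; last first.
    have b1' : 1 - b != 0 by rewrite subr_eq0 eq_sym.
    case/eqP: (nsq (a / (1 - b))); apply: (mulIf (expf_neq0 2 b1')).
    rewrite -exprMn divfK // sqrrB expr1n mul1r two0 subr0 mulrDr mulr1.
    by rewrite {1}edet [X in _ + X]mulrC -addrA -mulr2n two0 addr0.
  have a0 : a = 0.
    move/eqP: edet; rewrite b1 expr1n mul1r eq_sym -subr_eq0 addrK.
    by rewrite expf_eq0 => /eqP.
  move: e; rewrite a0 b1 raddf0 add0r scale1r => e.
  have [x [y ->]] := commutant2 nsA (esym e).
  by rewrite sqr_poly scalar_mx_is_scalar.
apply/val_inj/eqP; rewrite eqEsubset sPG andbT; apply/subsetP=> g Gg.
by apply: mem_P; rewrite // p2 G2.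
Qed.
End Structure.

(** * Embeddings of finite fields *)

Definition Fp_rmorphism (k : fieldType) p (charkp : p \in [pchar k]) :
    {rmorphism 'F_p -> k} :=
  GRing.RMorphism.clone 'F_p (pPrimeCharType charkp)
    (in_alg (pPrimeCharType charkp)) _.

(* Compare the products of [t] over [D] and over [h(D) = D]. *)
Lemma scaled_perm_expr_card (R : fieldType) (T : finType) (D : {pred T})
    (t : T -> R) (h : T -> T) (c : R) :
  injective h -> (forall x, (h x \in D) = (x \in D)) ->
  {in D, forall x, t x != 0} -> {in D, forall x, t (h x) = c * t x} ->
  c ^+ #|D| = 1.
Proof.
move=> h_inj hD t0 th; set pi := \prod_(x in D) t x.
have pi0 : pi != 0 by apply/prodf_neq0.
apply: (mulIf pi0); rewrite mul1r {2}/pi (reindex_inj h_inj) /=.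
rewrite (eq_bigl _ _ hD) (eq_bigr _ th) big_split /= prodr_const.
by rewrite -/pi.
Qed.

Lemma finField_unit_order (E : finFieldType) n : (n %| #|E|.-1)%N ->
  exists u : {unit E}, #[u]%g = n.
Proof.
move=> dvn; have E1 : (0 < #|E|.-1)%N.
  by rewrite -card_finField_unit cardG_gt0.
have /cyclicP[g Eg] := field_unit_group_cyclic [set: {unit E}]%G.
have og : #[g]%g = #|E|.-1 by rewrite -card_finField_unit Eg.
case/dvdnP: dvn E1 => q eE; rewrite eE muln_gt0 => /andP[q0 _].
by exists (g ^+ q)%g; rewrite orderXdiv og eE ?dvdn_mulr // mulKn.
Qed.

Lemma unit_prim_root (E : finFieldType) (u : {unit E}) :
  #[u]%g.-primitive_root (val u).
Proof.
apply: primitive_rootP => // j.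
by rewrite -FinRing.val_unitX order_dvdn -(inj_eq val_inj).
Qed.

Lemma order_mod_dvd n p e : is_order_mod n p e -> (n %| (p ^ e).-1)%N.
Proof.
case=> e0 pe _; case: p pe => [|p] pe; first by rewrite exp0n ?dvdn0.
by rewrite -subn1 -eqn_mod_dvd ?expn_gt0 //; apply/eqP.
Qed.

Lemma order_mod_leq n p e d : (0 < p)%N -> is_order_mod n p e -> (0 < d)%N ->
  (n %| (p ^ d).-1)%N -> (e <= d)%N.
Proof.
move=> p0 [_ _ min_e] d0 dv; apply: min_e => //; apply/eqP.
by rewrite eqn_mod_dvd ?expn_gt0 ?p0 // subn1.
Qed.

(** Let [w] be a primitive [n]-th root of unity of [E]. The field [F_p[w]] has [p ^ d] elements with
    [n] dividing [p ^ d - 1], so [d >= e] and [w] generates [E]. The minimal polynomial [mu] of [w]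
    divides [X^n - 1], which splits in [k] thanks to [z]; sending [w] to a root of [mu] in [k]
    embeds [E]. *)
Lemma finField_rmorphism (k : fieldType) p (charkp : p \in [pchar k])
    (E : finFieldType) e n (z : k) :
  #|E| = (p ^ e)%N -> is_order_mod n p e -> n.-primitive_root z ->
  inhabited {rmorphism E -> k}.
Proof.
move=> cE ord_e prim_z; have p_pr := pcharf_prime charkp.
have n0 := prim_order_gt0 prim_z; have [e0 _ _] := ord_e.
have charEp := card_finPcharP cE p_pr.
have [w prim_w] : exists w : E, n.-primitive_root w.
  have [|u ou] := @finField_unit_order E n; first by rewrite cE order_mod_dvd.
  by exists (val u); rewrite -ou unit_prim_root.
pose evE : {rmorphism {poly 'F_p} -> E} :=
  horner_morph (fun x => mulrC w (Fp_rmorphism charEp x)).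
have evX : evE 'X = w by apply: horner_morphX.
(* The least degree of a nonzero polynomial killing [w] provides the minimal polynomial. *)
pose kill d := `[< exists2 mu : {poly 'F_p}, size mu = d.+1 & evE mu = 0 >].
have ex_kill : exists d, kill d.
  exists n; apply/asboolP; exists ('X^n - 1); first by rewrite size_XnsubC.
  by rewrite rmorphB rmorphXn rmorph1 /= evX prim_expr_order ?subrr.
case: (ex_minnP ex_kill) => d /asboolP[mu size_mu evmu] min_d.
have mu0 : mu != 0 by rewrite -size_poly_gt0 size_mu.
have kerE Q : evE Q = 0 -> mu %| Q.
  move=> evQ; rewrite /dvdp -size_poly_eq0; apply/negPn/negP => Qmod0.
  have Qlt : (size (Q %% mu)%R < d.+1)%N by rewrite -size_mu ltn_modp.
  have : kill (size (Q %% mu)%R).-1.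
    apply/asboolP; exists (Q %% mu); first by rewrite prednK // lt0n.
    have := congr1 evE (divp_eq Q mu).
    by rewrite evQ rmorphD rmorphM /= evmu mulr0 add0r => <-.
  by move/min_d; rewrite leqNgt => /negP[]; rewrite -ltnS prednK ?lt0n.
pose vE (v : 'rV['F_p]_d) := evE (rVpoly v).
have vE_inj : injective vE.
  move=> u v /eqP; rewrite -subr_eq0 -rmorphB => /eqP/kerE dv.
  apply: (can_inj rVpolyK); apply/eqP; rewrite -subr_eq0.
  apply: contraTT dv => /dvdp_leq le_mu; apply/negP => /le_mu.
  by rewrite size_mu ltnNge -raddfB size_poly.
have vE_surj Q : exists v, evE Q = vE v.
  exists (poly_rV (Q %% mu)); rewrite /vE poly_rV_K.
    by rewrite {1}(divp_eq Q mu) rmorphD rmorphM /= evmu mulr0 add0r.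
  by rewrite -ltnS -size_mu ltn_modp.
pose S := [set vE v | v in 'rV['F_p]_d].
have cS : #|S| = (p ^ d)%N.
  by rewrite card_imset // card_mx card_Fp // mul1n.
have w0 : w != 0.
  apply/eqP=> w0; have := prim_expr_order prim_w.
  by rewrite w0 expr0n gtn_eqF // => /esym/eqP; rewrite oner_eq0.
have S_w x : (w * x \in S) = (x \in S).
  have Sw y : y \in S -> w * y \in S.
    case/imsetP=> v _ ->; have [u eu] := vE_surj ('X * rVpoly v).
    by apply/imsetP; exists u => //; rewrite -eu rmorphM /= evX.
  apply/idP/idP => [wx|]; last exact: Sw.
  have iter_S j y : y \in S -> w ^+ j * y \in S.
    by move=> Sy; elim: j => [|j IHj]; rewrite ?mul1r // exprS -mulrA Sw.
  have := iter_S n.-1 _ wx.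
  by rewrite mulrA -exprSr prednK // prim_expr_order // mul1r.
have S0 : 0 \in S.
  by apply/imsetP; exists 0 => //; rewrite /vE raddf0 rmorph0.
(* Multiplication by [w] permutes the nonzero elements of [F_p[w]], so [w] to the power of their
   number is 1. *)
have n_dvd : (n %| (p ^ d).-1)%N.
  have := @scaled_perm_expr_card _ _ (mem (S :\ 0)) id ( *%R w) w (mulfI w0).
  have -> : #|S :\ 0| = (p ^ d).-1 by rewrite -cS [in RHS](cardsD1 0 S) S0.
  rewrite (prim_order_dvd prim_w) => ->//.
  - by move=> x; rewrite !inE S_w mulf_eq0 (negPf w0).
  - by move=> x; rewrite !inE => /andP[].
have d0 : (0 < d)%N.
  rewrite lt0n; apply: contraNneq mu0 => d0; move/eqP: size_mu; rewrite d0.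
  case/size_poly1P=> c c0 ec; move/eqP: evmu; rewrite ec.
  by rewrite [evE _]horner_morphC fmorph_eq0 (negPf c0).
have ST : S = [set: E].
  apply/eqP; rewrite eqEcard subsetT cardsT cE cS leq_exp2l ?prime_gt1 //.
  exact: order_mod_leq (prime_gt0 p_pr) ord_e d0 n_dvd.
have lift_E x : exists Q, evE Q = x.
  have : x \in S by rewrite ST inE.
  by case/imsetP=> v _ ->; exists (rVpoly v).
have [lift liftK] := choice lift_E.
have iok : {rmorphism 'F_p -> k} := Fp_rmorphism charkp.
have [y mu_y] : exists y, root (map_poly iok mu) y.
  have : map_poly iok mu %| \prod_(0 <= i < n) ('X - (z ^+ i)%:P).
    rewrite factor_Xn_sub_1 // (_ : 'X^n - 1 = map_poly iok ('X^n - 1)).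
      rewrite dvdp_map kerE // rmorphB rmorphXn rmorph1 /=.
      by rewrite evX prim_expr_order ?subrr.
    by rewrite rmorphB /= map_polyXn rmorph1.
  case/dvdp_prod_XsubC=> m; case: (mask m _) => [|i s].
    rewrite big_nil => /eqp_size; rewrite size_map_poly size_mu size_poly1.
    by case: (d) d0.
  rewrite big_cons => /eqp_root rt; exists (z ^+ i).
  by rewrite rt rootM root_XsubC eqxx.
pose evk : {rmorphism {poly 'F_p} -> k} :=
  horner_morph (fun x => mulrC y (iok x)).
(* The image of an element of [E] does not depend on the polynomial representing it, because [y] is
   a root of [mu]. *)
have ev_eq Q Q' : evE Q = evE Q' -> evk Q = evk Q'.
  move/eqP; rewrite -subr_eq0 -rmorphB => /eqP/kerE/dvdpP[R eR].
  apply/eqP; rewrite -subr_eq0 -rmorphB eR rmorphM /=.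
  by rewrite [X in _ * X](eqP mu_y) mulr0.
pose phi x := evk (lift x).
have phiB : GRing.zmod_morphism phi.
  by move=> a b; rewrite /phi -rmorphB; apply: ev_eq; rewrite rmorphB /= !liftK.
have phiM : GRing.monoid_morphism phi.
  split=> [|a b]; last first.
    by rewrite /phi -rmorphM; apply: ev_eq; rewrite rmorphM /= !liftK.
  by rewrite /phi -(rmorph1 evk); apply: ev_eq; rewrite liftK rmorph1.
split; exact: (HB.pack phi (GRing.isZmodMorphism.Build E k phi phiB)
                 (GRing.isMonoidMorphism.Build E k phi phiM)).
Qed.

(** * Semi-elementary subgroups *)

Lemma contains_Fq_prim_root (k : fieldType) p (charkp : p \in [pchar k])
    e n (z : k) :
  is_order_mod n p e -> n.-primitive_root z -> contains_Fq k (p ^ e).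
Proof.
move=> ord_e prim_z; have [e0 _ _] := ord_e.
have [E _ cE] := pPrimePowerField (pcharf_prime charkp) e0.
by exists E => //; apply: finField_rmorphism ord_e prim_z.
Qed.

Lemma order_mod_dvdn n p e d : (0 < p)%N -> is_order_mod n p e ->
  (n %| (p ^ d).-1)%N -> (e %| d)%N.
Proof.
move=> p0 ord_e; have [e0 pe _] := ord_e.
have dvE j : (n %| (p ^ j).-1)%N = (p ^ j == 1 %[mod n]).
  by rewrite eqn_mod_dvd ?expn_gt0 ?p0 // subn1.
have peX j : ((p ^ e) ^ j = 1 %[mod n])%N by rewrite -modnXm pe modnXm exp1n.
rewrite dvE [in X in X -> _](divn_eq d e) expnD mulnC [(_ %/ _ * _)%N]mulnC expnM.
rewrite -modnMmr peX modnMmr muln1 -dvE => dv; apply/negPn/negP.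
rewrite -lt0n => r0; have := order_mod_leq p0 ord_e r0 dv.
by rewrite leqNgt ltn_pmod.
Qed.

Section Dimension.
Variables (k : fieldType) (p : nat).
Hypothesis charkp : p \in [pchar k].

Lemma Fp_scaleE (V : lmodType 'F_p) (c : 'F_p) (v : V) : c *: v = v *+ c.
Proof. by rewrite -{1}[c]natr_Zp scaler_nat. Qed.

(** Over the prime field additive maps are linear, so the image of the standard basis is free. *)
Lemma le_dim_additive m (phi : 'rV['F_p]_m -> k) :
  {morph phi : u v / u + v} -> injective phi ->
  le_dim m (pPrimeCharType charkp : lmodType 'F_p).
Proof.
move=> phiD phi_inj.
have phi0 : phi 0 = 0 by apply: (addrI (phi 0)); rewrite -phiD !addr0.
have phiMn u j : phi (u *+ j) = phi u *+ j.
  by elim: j => [|j IHj]; rewrite ?mulr0n // !mulrS phiD IHj.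
exists (fun i => phi (delta_mx 0 i) : pPrimeCharType charkp) => c sum0 i.
suff /rowP/(_ i) : \row_i c i = 0 by rewrite !mxE.
apply: phi_inj; rewrite phi0 -[RHS]sum0 (row_sum_delta (\row_i c i)).
rewrite (big_morph phi phiD phi0); apply: eq_bigr => j _.
by rewrite mxE !Fp_scaleE phiMn.
Qed.

Lemma le_dim_embedding m : le_dim m (pPrimeCharType charkp : lmodType 'F_p) ->
  exists phi : 'rV['F_p]_m -> k, injective phi.
Proof.
case=> v v_free; exists (fun u => \sum_i u 0 i *: v i) => u u' e.
apply/rowP=> i; apply/eqP; rewrite -subr_eq0; apply/eqP.
apply: (v_free (fun i => u 0 i - u' 0 i)).
rewrite (eq_bigr _ (fun i _ => scalerBl (u 0 i) (u' 0 i) (v i))) sumrB.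
by apply/eqP; rewrite subr_eq0; apply/eqP.
Qed.

(** A free family is built greedily, each new vector [y] being taken outside the span of the
    previous ones. The hypothesis concerns arbitrary maps [w], so that a counting argument can
    supply it. *)
Lemma semilinear_embedding (F : finFieldType) (io : {rmorphism F -> k}) d :
  (forall j (w : 'rV[F]_j -> k), (j < d)%N -> exists y, forall u, w u != y) ->
  exists w : 'rV[F]_d -> k,
    [/\ {morph w : u v / u + v}, forall a u, w (a *: u) = io a * w u
      & injective w].
Proof.
elim: d => [|d IHd] out_w.
  exists (fun=> 0); split=> [u v|a u|u v _]; rewrite ?addr0 ?mulr0 //.
  by apply/rowP=> [[]].
have [j w jd|w [wD wZ w_inj]] := IHd; first by apply: out_w; rewrite ltnS ltnW.
have [y wy] := out_w d w (ltnSn d).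
pose w' (u : 'rV[F]_(1 + d)) := io (lsubmx u 0 0) * y + w (rsubmx u).
have w'D : {morph w' : u v / u + v}.
  by move=> u v; rewrite /w' !linearD /= mxE rmorphD wD /= mulrDl addrACA.
have w'Z a u : w' (a *: u) = io a * w' u.
  by rewrite /w' !linearZ /= mxE rmorphM wZ /= mulrDr mulrA.
exists w'; split=> // u v e.
have w'B : w' (u - v) = 0.
  by rewrite -scaleN1r w'D w'Z rmorphN1 mulN1r e subrr.
have w0 : w 0 = 0 by rewrite -(scale0r 0) wZ rmorph0 mul0r.
apply/eqP; rewrite -subr_eq0; move: {u v e} (u - v) w'B => u.
rewrite /w'; move: (@hsubmxK F 1 1 d u).
move: (@lsubmx F 1 1 d u) (@rsubmx F 1 1 d u) => l r <- {u} e.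
have [l0|l0] := eqVneq (l 0 0) 0.
  move: e; rewrite l0 rmorph0 mul0r add0r -w0 => /w_inj ->.
  have -> : l = 0 by apply/rowP=> i; rewrite ord1 l0 mxE.
  by rewrite row_mx0.
(* A nonzero coefficient of [y] in the relation would put [y] in the image of [w]. *)
case/eqP: (wy (- (l 0 0)^-1 *: r)); rewrite wZ.
have io0 : io (l 0 0) != 0 by rewrite fmorph_eq0.
apply: (mulfI io0); rewrite mulrA -rmorphM mulrN divff // rmorphN1 mulN1r.
by apply/esym/eqP; rewrite -addr_eq0 e.
Qed.
End Dimension.

Section SemiElementary.
Variables (k : fieldType) (p : nat).
Hypothesis charkp : p \in [pchar k].

(** Squaring is injective in characteristic 2, so on a finite field it is onto; a nonsquare forces
    [k] to be infinite, and no map from a finite space is onto [k]. *)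
Lemma nonsquare_le_dim (d : k) m : p = 2%N -> (forall s, s ^+ 2 != d) ->
  le_dim m (pPrimeCharType charkp : lmodType 'F_p).
Proof.
move=> p2 nsq.
have [|w [wD _ w_inj]] := @semilinear_embedding k 'F_p (Fp_rmorphism charkp) m.
  move=> j w _; apply: contrapT => surj.
  have sqr_inj : injective (fun x : k => x ^+ 2).
    move=> x y /eqP; rewrite eqf_sqr => /orP[/eqP//|/eqP->].
    by apply/eqP; rewrite eq_sym -addr_eq0 -mulr2n -mulr_natr -p2 pcharf0 ?mulr0.
  pose S := undup (codom w).
  have inS x : x \in S.
    rewrite mem_undup; apply/negPn/negP => nSx; apply: surj; exists x => u.
    by apply: contraNneq nSx => <-; apply: codom_f.
  have uS : uniq (map (fun x => x ^+ 2) S).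
    by rewrite map_inj_uniq ?undup_uniq.
  have [||_ eS] := uniq_min_size uS (s2 := S); first by move=> x _; apply: inS.
    by rewrite size_map.
  have /mapP[s _ ds] : d \in map (fun x => x ^+ 2) S by rewrite eS.
  by have := nsq s; rewrite ds eqxx.
exact: le_dim_additive wD w_inj.
Qed.

Lemma semi_elementary_sub m n e (gT : finGroupType) (G : {group gT}) :
  ~~ (p %| n)%N -> is_order_mod n p e -> p_semi_elementary p G ->
  #|G| = (p ^ m * n)%N -> contains_subgroup_isog (PGL2 k) G ->
  [/\ contains_Fq k (p ^ e), (e %| m)%N
    & le_dim m (pPrimeCharType charkp : lmodType 'F_p)].
Proof.
move=> pn ord_e [P [SylP expP cycGP]] cG.
case/(contains_subgroup_isogP _ (group_closed_fingroup G)) => f [fM fI].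
have p_pr := pcharf_prime charkp; have p0 := prime_gt0 p_pr.
have [sylP nPG] : (p.-Sylow(G) P)%g /\ (P <| G)%g.
  have /normal_sylowP[Q sylQ nQG] : #|('Syl_p(G))%g| == 1%N.
    by rewrite SylP cards1.
  suff <- : Q = P by [].
  by apply/set1P; rewrite -SylP inE.
have sPG := normal_sub nPG.
have n0 : (0 < n)%N by case: (n) pn; rewrite ?dvdn0.
have cP : #|P| = (p ^ m)%N.
  rewrite (card_Hall sylP) cG partnM ?expn_gt0 ?p0 // part_pnat_id ?pnatX ?pnat_id //.
  by rewrite part_p'nat ?muln1 // p'natE.
have cGP : #|(G / P)%g| = n.
  by rewrite card_quotient ?normal_norm // -divgS // cG cP mulKn ?expn_gt0 ?p0.
have [|[p2 eGP [d nsq]]] := borel_structure charkp fM fI sylP nPG expP; last first.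
  (* In the inseparable case [G = P], so [n = e = 1], and only the dimension bound has content. *)
  have n1 : n = 1%N by rewrite -cGP eGP trivg_quotient cards1.
  have e1 : e = 1%N.
    have [e0 _ min_e] := ord_e; apply/eqP; rewrite eqn_leq e0 andbT.
    by apply: min_e => //; rewrite n1 !modn1.
  split; last exact: nonsquare_le_dim p2 nsq; last by rewrite e1 dvd1n.
  apply: (contains_Fq_prim_root charkp (z := 1) ord_e); rewrite n1.
  by apply: primitive_rootP => // j; rewrite expr1n eqxx dvd1n.
case=> chi [tau [chiM chi1 tauD tau_inj tauJ]].
have /cyclicP[xb def_xb] := cycGP.
have /morphimP[g Ng Gg def_g] : xb \in (G / P)%g by rewrite def_xb cycle_id.
have chiX j : chi (g ^+ j)%g = chi g ^+ j.
  elim: j => [|j IHj]; first by apply/eqP; rewrite expg0 expr0 chi1.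
  by rewrite expgS exprS chiM ?groupX // IHj.
have prim_chi : n.-primitive_root (chi g).
  apply: primitive_rootP => // j; rewrite -chiX chi1; last exact: groupX.
  rewrite -cGP def_xb -[#|_|]/(#[xb]%g) order_dvdn def_g -morphX //=.
  by apply/idP/eqP; [apply: coset_id | apply: coset_idr; rewrite groupX].
have n_dvd : (n %| (p ^ m).-1)%N.
  have := @scaled_perm_expr_card _ _ (mem P^#%g) tau (conjg^~ g) (chi g)
    (conjg_inj g).
  have -> : #|P^#%g| = (p ^ m).-1 by rewrite -cP [in RHS](cardsD1 1%g) group1.
  rewrite (prim_order_dvd prim_chi) => ->//.
  - by move=> x; rewrite !inE conjg_eq1 memJ_norm.
  - by move=> x; rewrite !inE => /andP[nx1 Px]; apply: contraNneq nx1 => /tau_inj->.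
  - by move=> x; rewrite !inE => /andP[_ Px]; apply: tauJ.
split; first exact: contains_Fq_prim_root ord_e prim_chi.
  exact: order_mod_dvdn p0 ord_e n_dvd.
have tauI : {in P &, injective tau}.
  move=> x y Px Py exy; apply/eqP; rewrite eq_mulgV1; apply/eqP/tau_inj.
    by rewrite groupM ?groupV.
  apply: (addIr (tau y)); rewrite -tauD ?groupM ?groupV // mulgKV add0r.
  exact: exy.
have ntP : P != 1%G :> {group gT}.
  by apply: contraTneq p_pr => P1; rewrite -expP P1 exponent1.
(* [tau] embeds [P] in the additive group of [k], so [P] is a vector space over [F_p], of dimension
   [m]. *)
have abelP : (p.-abelem P)%g.
  rewrite abelemE // expP dvdnn andbT; apply/centsP=> x Px y Py.
  by apply: tauI; rewrite ?groupM // !tauD // addrC.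
have <- : 'dim P = m by rewrite (dim_abelemE abelP ntP) cP pfactorK.
apply: (@le_dim_additive _ _ charkp _ (tau \o rVabelem abelP ntP)).
  by move=> u v; rewrite /= rVabelemD tauD // mem_rVabelem.
move=> u v /tauI euv; apply: (@rVabelem_inj _ _ _ abelP ntP); apply: euv.
  exact: mem_rVabelem.
exact: mem_rVabelem.
Qed.
End SemiElementary.

(** * Affine groups *)

(** The pair [(v, a)] is the map [x -> a x + v]. Over a finite field these give the semi-elementary
    groups, and over ['Z_n] the dihedral ones. *)
Definition affine (R : finUnitRingType) (d : nat) : Type :=
  ('rV[R]_d * {unit R})%type.

Section Affine.
Variables (R : finUnitRingType) (d : nat).
HB.instance Definition _ := Finite.on (affine R d).

Implicit Types x y : affine R d.

Definition affine_mul x y : affine R d := (x.1 + val x.2 *: y.1, x.2 * y.2)%g.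
Definition affine_one : affine R d := (0, 1%g).
Definition affine_inv x : affine R d := (- (val x.2^-1%g *: x.1), x.2^-1)%g.

Lemma affine_mulA : associative affine_mul.
Proof.
by move=> x y z; rewrite /affine_mul /= scalerDr scalerA !addrA mulgA.
Qed.

Lemma affine_mul1 : left_id affine_one affine_mul.
Proof. by case=> v a; rewrite /affine_mul /= add0r scale1r mul1g. Qed.

Lemma affine_mulV : left_inverse affine_one affine_inv affine_mul.
Proof. by case=> v a; rewrite /affine_mul /= addNr mulVg. Qed.

HB.instance Definition _ :=
  Finite_isGroup.Build (affine R d) affine_mulA affine_mul1 affine_mulV.

Lemma affineM x y : (x * y)%g = (x.1 + val x.2 *: y.1, x.2 * y.2)%g.
Proof. by []. Qed.

Definition affine_sub (z : {unit R}) : {set affine R d} :=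
  [set x | x.2 \in <[z]>%g].

Lemma affine_sub_group_set z : group_set (affine_sub z).
Proof.
apply/group_setP; split=> [|x y]; rewrite !inE ?group1 //.
by apply: groupM.
Qed.
Canonical affine_sub_group z := Group (affine_sub_group_set z).

Lemma card_affine_sub z : #|affine_sub z| = (#|R| ^ d * #[z]%g)%N.
Proof.
have -> : affine_sub z = setX [set: 'rV[R]_d] <[z]>%g.
  by apply/setP=> x; rewrite !inE.
by rewrite cardsX cardsT card_mx mul1n.
Qed.

Lemma affine_transX (v : 'rV[R]_d) j :
  (((v, 1) : affine R d) ^+ j)%g = (v *+ j, 1%g).
Proof.
elim: j => [|j IHj]; first by rewrite expg0 mulr0n.
by rewrite expgS IHj affineM /= scale1r mulg1 mulrS.
Qed.

Lemma affine_rotX (a : {unit R}) j :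
  (((0, a) : affine R d) ^+ j)%g = (0, (a ^+ j)%g).
Proof.
elim: j => [|j IHj]; first by rewrite !expg0.
by rewrite expgS IHj affineM /= scaler0 addr0 expgS.
Qed.
End Affine.

Lemma prime_ndvd_pred_expn p r n : prime p -> (0 < r)%N ->
  (n %| (p ^ r).-1)%N -> ~~ (p %| n)%N.
Proof.
move=> p_pr r0 dvn; apply/negP => /dvdn_trans/(_ dvn) dvp.
have : (p %| (p ^ r).-1 + 1)%N by rewrite addn1 prednK ?expn_gt0 ?prime_gt0 // dvdn_exp.
by rewrite dvdn_addr // dvdn1; apply/negP; rewrite neq_ltn prime_gt1 // orbT.
Qed.

(** The order of [z] divides [p ^ e - 1], so the translations [T] form the Sylow subgroup, and [z]
    generates the quotient. Positivity of [d] makes the exponent [p] rather than 1. *)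
Lemma affine_semi_elementary (F : finFieldType) p e d (z : {unit F}) :
  prime p -> (0 < e)%N -> (0 < d)%N -> #|F| = (p ^ e)%N ->
  p_semi_elementary p (affine_sub_group d z).
Proof.
move=> p_pr e0 d0 cF; set G := affine_sub_group d z.
have charFp := card_finPcharP cF p_pr.
have p_oz : ~~ (p %| #[z]%g)%N.
  apply: (@prime_ndvd_pred_expn p e); rewrite // -cF -card_finField_unit.
  by rewrite order_dvdG ?inE.
pose T := affine_sub_group d (1 : {unit F})%g.
have memT x : (x \in T) = (x.2 == 1%g) by rewrite inE cycle1 inE.
have sTG : T \subset G.
  by apply/subsetP=> x; rewrite memT inE => /eqP->; apply: group1.
have nTG : (T <| G)%g.
  rewrite /normal sTG; apply/subsetP=> g _; rewrite inE.
  apply/subsetP=> _ /imsetP[x Tx ->]; move: Tx; rewrite !memT => /eqP x1.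
  by rewrite conjgE /= x1 mul1g mulVg.
have cT : #|T| = (p ^ (e * d))%N by rewrite card_affine_sub order1 muln1 cF expnM.
have cG : #|G| = (p ^ (e * d) * #[z]%g)%N by rewrite card_affine_sub cF expnM.
have p_gt0 := prime_gt0 p_pr.
have sylT : (p.-Sylow(G) T)%g.
  rewrite pHallE sTG cT cG partnM ?expn_gt0 ?p_gt0 //.
  rewrite part_pnat_id ?pnatX ?pnat_id // part_p'nat ?muln1 ?eqxx //.
  by rewrite p'natE.
exists T; split.
- apply/setP=> Q; rewrite !inE; apply/idP/eqP => [sylQ|->//].
  apply/val_inj/eqP; rewrite eqEcard (card_Hall sylT) (card_Hall sylQ) leqnn andbT.
  by rewrite (sub_normal_Hall sylT nTG) ?(pHall_sub sylQ) ?(pHall_pgroup sylQ).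
- have nt_exp : exponent T != 1%N.
    rewrite -dvdn1 -trivg_exponent -cardG_gt1 cT -(exp1n (e * d)).
    by rewrite ltn_exp2r ?prime_gt1 // muln_gt0 e0.
  apply/(prime_nt_dvdP p_pr nt_exp)/exponentP=> [[v a]].
  rewrite memT /= => /eqP->.
  by rewrite affine_transX -scaler_nat pcharf0 ?scale0r.
apply/cyclicP; exists (coset T (0, z)); apply/eqP; rewrite eqEsubset.
have Nz : ((0, z) : affine F d) \in 'N(T)%g.
  by apply: (subsetP (normal_norm nTG)); rewrite inE cycle_id.
apply/andP; split; last first.
  by rewrite cycle_subG mem_quotient // inE cycle_id.
apply/subsetP=> x /morphimP[[v a] _]; rewrite inE /= => /cycleP[i ei] ->.
rewrite {}ei.
have -> : (v, (z ^+ i)%g) = (((v, 1) : affine F d) * ((0%R, z) : affine F d) ^+ i)%g.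
  by rewrite affine_rotX affineM /= scaler0 addr0 mul1g.
have Tv : ((v, 1%g) : affine F d) \in T by rewrite memT.
rewrite morphM ?groupX ?(subsetP (normal_norm nTG) _ (subsetP sTG _ Tv)) //=.
by rewrite coset_id // mul1g morphX // mem_cycle.
Qed.

Lemma affine_pgl_embedding (F : finFieldType) (K : fieldType) d
    (io : {rmorphism F -> K}) (w : 'rV[F]_d -> K) :
  {morph w : u v / u + v} -> (forall a u, w (a *: u) = io a * w u) ->
  injective w ->
  let f (x : affine F d) := pgl (mx2 (io (val x.2)) (w x.1) 0 1) in
  {morph f : x y / (x * y)%g} /\ injective f.
Proof.
move=> wD wZ w_inj f.
have uf (a : {unit F}) v : mx2 (io (val a)) v 0 1 \is a GRing.unit.
  rewrite -[_ \is a _]unitmxE unitmxE det_mx2 mulr1 mulr0 subr0 unitfE fmorph_eq0.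
  by rewrite -unitfE (valP a).
split=> [x y|[u a] [v b]]; rewrite /f.
  rewrite -pglM ?uf // mx2M; congr pgl; rewrite /= rmorphM wD wZ.
  by congr mx2; ring.
case/pglP => [||c c0]; rewrite ?uf //= mx2Z => /mx2_inj[ea ev _].
rewrite mulr1 => c1; rewrite -c1 !mul1r in ea ev.
by rewrite (w_inj _ _ ev) (val_inj (fmorph_inj _ ea)).
Qed.

Section SemiElementaryConverse.
Variables (k : fieldType) (p : nat).
Hypothesis charkp : p \in [pchar k].

Lemma semi_elementary_exists m n e :
  (0 < m)%N -> is_order_mod n p e -> contains_Fq k (p ^ e) -> (e %| m)%N ->
  le_dim m (pPrimeCharType charkp : lmodType 'F_p) ->
  exists (gT : finGroupType) (G : {group gT}),
    [/\ p_semi_elementary p G, #|G| = (p ^ m * n)%N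
      & contains_subgroup_isog (PGL2 k) G].
Proof.
move=> m0 ord_e [F cF [io]] /dvdnP[d em] /le_dim_embedding[phi phi_inj].
have p_pr := pcharf_prime charkp; have p1 := prime_gt1 p_pr.
have [e0 _ _] := ord_e.
have d0 : (0 < d)%N by move: m0; rewrite em muln_gt0 => /andP[].
have [u ou] : exists u : {unit F}, #[u]%g = n.
  by apply: finField_unit_order; rewrite cF order_mod_dvd.
have [|w [wD wZ w_inj]] := @semilinear_embedding k F io d.
  (* A map from [F^j] onto [k] would, through a section, inject the [p ^ m = #|F| ^ d] vectors
     embedded in [k] into [F^j], which is smaller. *)
  move=> j w jd; apply: contrapT => no_y.
  have pre v : exists v', w v' = phi v.
    apply: contrapT => no_v; apply: no_y; exists (phi v) => v'.
    by apply/eqP => ev; apply: no_v; exists v'.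
  have [h hE] := choice pre.
  have h_inj : injective h by move=> v v' eh; apply: phi_inj; rewrite -!hE eh.
  have := leq_card h h_inj; rewrite !card_mx !mul1n card_Fp // cF -expnM em.
  by rewrite leq_exp2l // mulnC leq_pmul2l // leqNgt jd.
have [fM fI] := affine_pgl_embedding wD wZ w_inj.
exists (affine F d), (affine_sub_group d u); split.
- exact: affine_semi_elementary p_pr e0 d0 cF.
- by rewrite card_affine_sub cF ou -expnM em [(e * d)%N]mulnC.
apply/(contains_subgroup_isogP _ (group_closed_fingroup _)).
by eexists; split; [move=> x y _ _; apply: fM | move=> x y _ _; apply: fI].
Qed.
End SemiElementaryConverse.

(** If [n] divided [p ^ d - 1] with [d < r], then [2 n <= 2 p ^ d - 2 < p ^ r - 1]. The factor 2
    covers the group of squares, of index at most 2. *)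
Lemma is_order_mod_pred_expn p r n : prime p -> (0 < r)%N ->
  (n %| (p ^ r).-1)%N -> ((p ^ r).-1 <= 2 * n)%N -> is_order_mod n p r.
Proof.
move=> p_pr r0 dvn le_n; have p1 := prime_gt1 p_pr; have p0 := ltnW p1.
have dvE j : (n %| (p ^ j).-1)%N = (p ^ j == 1 %[mod n]).
  by rewrite eqn_mod_dvd ?expn_gt0 ?p0 // subn1.
split=> //; first by apply/eqP; rewrite -dvE.
move=> d d0 /eqP; rewrite -dvE => dvd; rewrite leqNgt; apply/negP => dr.
have pd : (1 < p ^ d)%N by rewrite -(exp1n d) ltn_exp2r.
have := dvdn_leq _ dvd; rewrite -ltnS prednK ?(ltnW pd) // => /(_ pd) nd.
have : (2 * p ^ d <= p ^ r)%N.
  by apply: leq_trans (leq_pexp2l p0 dr); rewrite expnS leq_mul2r p1 orbT.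
move: le_n nd; rewrite !mul2n -!addnn.
by lia.
Qed.

(** * Projective linear groups of finite fields *)

Lemma group_closed_predT (G : groupType) : group_closed (predT : {pred G}).
Proof. by []. Qed.

Lemma group_closed_PSL2 (F : fieldType) : group_closed (PSL2 F).
Proof.
have d1 : detbar (1%g : PGL2 F) = 1%g.
  by apply: (mulgI (detbar 1%g)); rewrite -detbarM !mulg1.
split=> [|x y]; rewrite !inE ?d1 // => /eqP dx /eqP dy.
apply/eqP; apply: (mulIg (detbar y)).
by rewrite -detbarM mulgVK dx dy mulg1.
Qed.

Lemma pgl_PSL2 (F : fieldType) (A : 'M[F]_2) (c : F) :
  \det A = c ^+ 2 -> c != 0 -> pgl A \in PSL2 F.
Proof.
move=> dA c0; have uc : c \is a GRing.unit by rewrite unitfE.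
have uA : A \is a GRing.unit.
  by rewrite unit_mx2E dA expf_neq0.
rewrite inE /pgl detbarE; apply/eqP/quot_piP/asboolP.
exists (Units uc); apply/val_inj.
by rewrite /= val_insubd uA invr1 mulr1 dA.
Qed.

Section BaseChange.
Variables (F K : fieldType) (io : {rmorphism F -> K}).

Definition pgl_map (x : PGL2 F) : PGL2 K := pgl (map_mx io (pgl_lift x)).

Lemma map_mx_unit2 (A : 'M[F]_2) :
  A \is a GRing.unit -> map_mx io A \is a GRing.unit.
Proof.
by rewrite !unit_mx2E det_map_mx fmorph_eq0.
Qed.

Lemma pgl_mapM : {morph pgl_map : x y / (x * y)%g}.
Proof.
move=> x y; have [c c0 e] := pgl_liftM x y.
have ux := pgl_lift_unit x; have uy := pgl_lift_unit y.
rewrite /pgl_map -pglM ?map_mx_unit2 // pglP; last first.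
- by rewrite unitrMl map_mx_unit2.
- by rewrite map_mx_unit2 ?pgl_lift_unit.
by exists (io c); rewrite ?fmorph_eq0 // e map_mxZ map_mxM.
Qed.

Lemma pgl_map_inj : injective pgl_map.
Proof.
have ker x : pgl_map x = 1%g -> x = 1%g.
  rewrite /pgl_map pgl_eq1 ?map_mx_unit2 ?pgl_lift_unit // => sc.
  apply: pgl_lift_scalar; move: sc; rewrite [pgl_lift x]mx2_eta.
  move: (pgl_lift x) => A; rewrite (_ : map_mx _ _ =
    mx2 (io (A 0 0)) (io (A 0 1)) (io (A 1 0)) (io (A 1 1))); last first.
    by rewrite [LHS]mx2_eta !mxE.
  case/mx2_scalarP=> /fmorph_inj e /eqP b0 /eqP c0; apply/mx2_scalarP.
  by move: b0 c0; rewrite !fmorph_eq0 => /eqP-> /eqP->.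
move=> x y; apply: (closed_morph_inj (group_closed_predT _)) => //.
  by move=> u v _ _; apply: pgl_mapM.
by move=> u _; apply: ker.
Qed.
End BaseChange.

Section PSL.
Variables (k : fieldType) (p : nat).
Hypothesis charkp : p \in [pchar k].
Variables (r : nat) (Fq : finFieldType).
Hypotheses (r0 : (0 < r)%N) (cFq : #|Fq| = (p ^ r)%N).

Let p_pr : prime p := pcharf_prime charkp.

(** [contains_Fq] provides some field with [p ^ r] elements; its root of unity of order [p ^ r - 1]
    lets the given [Fq] embed too. *)
Lemma contains_Fq_rmorphism :
  contains_Fq k (p ^ r) -> inhabited {rmorphism Fq -> k}.
Proof.
case=> F cF [io]; have [u ou] := @finField_unit_order F _ (dvdnn _).
apply: (@finField_rmorphism k p charkp Fq r (p ^ r).-1 (io (val u)) cFq).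
  by apply: is_order_mod_pred_expn => //; rewrite leq_pmull.
by rewrite fmorph_primitive_root -cF -ou unit_prim_root.
Qed.

Lemma contains_PGL2 : contains_Fq k (p ^ r) ->
  contains_subgroup_isog (PGL2 k) (H := PGL2 Fq) predT.
Proof.
case/contains_Fq_rmorphism=> io.
apply/(contains_subgroup_isogP _ (group_closed_predT _)).
exists (pgl_map io); split=> x y _ _; first exact: pgl_mapM.
exact: pgl_map_inj.
Qed.

Lemma contains_PGL2_PSL2 :
  contains_subgroup_isog (PGL2 k) (H := PGL2 Fq) predT ->
  contains_subgroup_isog (PGL2 k) (PSL2 Fq).
Proof.
case/(contains_subgroup_isogP _ (group_closed_predT _)) => f [fM fI].
apply/(contains_subgroup_isogP _ (@group_closed_PSL2 _)).
by exists f; split=> x y _ _; [apply: fM | apply: fI].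
Qed.

(* The upper triangular subgroup of [PSL2 Fq] acts on its unipotent radical   *)
(* through the squares of [Fq], whose number determines [r].                  *)
Lemma contains_PSL2_Fq :
  contains_subgroup_isog (PGL2 k) (PSL2 Fq) -> contains_Fq k (p ^ r).
Proof.
case/(contains_subgroup_isogP _ (@group_closed_PSL2 _)) => f [fM fI].
have [g og] := @finField_unit_order Fq _ (dvdnn _).
(* Taking [g ^ 2] makes every determinant in the triangular group a square, which places it in
   [PSL2 Fq]. *)
pose z := (g ^+ 2)%g; pose G := affine_sub_group 1 z.
have z_dvd : (#[z]%g %| (p ^ r).-1)%N.
  by rewrite -cFq -card_finField_unit order_dvdG ?inE.
have ord_z : is_order_mod #[z]%g p r.
  apply: is_order_mod_pred_expn => //; rewrite -cFq -og; apply: dvdn_leq.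
    by rewrite muln_gt0 order_gt0.
  by rewrite order_dvdn expgM expg_order.
pose w (u : 'rV[Fq]_1) := u 0 0.
have [|||jM jI] := @affine_pgl_embedding Fq Fq 1 idfun w.
- by move=> u v; rewrite /w mxE.
- by move=> a u; rewrite /w mxE.
- by move=> u v e; apply/rowP=> i; rewrite ord1.
set j := (fun x : affine Fq 1 => _) in jM jI.
have jG x : x \in G -> j x \in PSL2 Fq.
  rewrite inE => /cycleP[i ex]; apply: (@pgl_PSL2 _ _ (val (g ^+ i)%g)).
    rewrite det_mx2 /= mulr1 mulr0 subr0 ex -expgM mulnC expgM.
    by rewrite !FinRing.val_unitX.
  by rewrite -unitfE (valP (g ^+ i)%g).
have [||||//] := @semi_elementary_sub k p charkp r #[z]%g r _ G _ ord_z.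
- exact: prime_ndvd_pred_expn z_dvd.
- exact: affine_semi_elementary cFq.
- by rewrite card_affine_sub cFq expn1.
apply/(contains_subgroup_isogP _ (group_closed_fingroup _)).
exists (f \o j); split=> x y Gx Gy /=; first by rewrite jM fM ?jG.
by move/fI=> e; apply: jI; apply: e; apply: jG.
Qed.
End PSL.

(** * Dihedral subgroups in characteristic two *)

Section Lucas.
Variable K : fieldType.
Implicit Types A : 'M[K]_2.

(** The Lucas sequence [U_n(T, D)], equal to [(a ^ n - b ^ n) / (a - b)] for distinct roots [a], [b]
    of [X^2 - T X + D]; it is the coefficient of [A] in [A ^ n]. *)
Fixpoint lucas (T D : K) (n : nat) : K :=
  if n is n1.+1 then
    if n1 is n2.+1 then T * lucas T D n1 - D * lucas T D n2 else 1
  else 0.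

Lemma lucasSS T D n : lucas T D n.+2 = T * lucas T D n.+1 - D * lucas T D n.
Proof. by []. Qed.

Lemma expr_mx2 A n :
  A ^+ n.+1 = lucas (\tr A) (\det A) n.+1 *: A
              - (\det A * lucas (\tr A) (\det A) n)%:M.
Proof.
elim: n => [|n IHn]; first by rewrite expr1 scale1r mulr0 raddf0 subr0.
rewrite exprS IHn lucasSS mulrBr -scalerAr -expr2 Cayley_Hamilton2 scalar_mx2C.
rewrite scalerBr scalerA scale_scalar_mx scalerBl [_ * \tr A]mulrC.
by rewrite [_ * \det A]mulrC addrAC.
Qed.

Lemma expr_mx2_scalar A n : ~~ is_scalar_mx A ->
  is_scalar_mx (A ^+ n) = (lucas (\tr A) (\det A) n == 0).
Proof.
move=> nsA; case: n => [|n]; first by rewrite expr0 scalar_mx_is_scalar eqxx.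
rewrite expr_mx2; apply/idP/eqP => [sc|->]; last first.
  by rewrite scale0r add0r -raddfN scalar_mx_is_scalar.
apply/eqP; apply: contraNT nsA => u0.
case/is_scalar_mxP: (scalar_addr_scalar_mx sc) => c e.
exact: scale_is_scalar_mx u0 e.
Qed.

Lemma lucas_root (L : fieldType) (io : {rmorphism K -> L}) (T : K) (z : L) n :
  z != 0 -> io T = z + z^-1 ->
  (z - z^-1) * io (lucas T 1 n) = z ^+ n - z^-1 ^+ n.
Proof.
move=> z0 eT; elim/ltn_ind: n => -[|[|n]] IHn.
- by rewrite rmorph0 mulr0 !expr0 subrr.
- by rewrite rmorph1 mulr1 !expr1.
rewrite lucasSS rmorphB !rmorphM rmorph1 mulrBr mul1r mulrCA !IHn //= eT.
by rewrite !exprS; field.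
Qed.

(** [A ^ n] is scalar when [U_n = 0], that is [z ^ n = z ^ -n], that is [z ^ (2 n) = 1], and
    squaring is injective. The nonzero trace ensures that [A] is not scalar and that [z] differs
    from [z^-1]. *)
Lemma char2_scalar_expr (L : fieldType) (io : {rmorphism K -> L}) A (z : L) n :
  2%N \in [pchar K] -> \det A = 1 -> \tr A != 0 -> z != 0 ->
  io (\tr A) = z + z^-1 -> is_scalar_mx (A ^+ n) = (z ^+ n == 1).
Proof.
move=> char2 dA tA z0 eT; rewrite expr_mx2_scalar; last first.
  apply: contraNN tA => /is_scalar_mxP[c ->].
  by rewrite mxtrace_scalar -mulr_natr pcharf0 ?mulr0.
have char2L : 2%N \in [pchar L] by rewrite (fmorph_pchar io).
have zz0 : z - z^-1 != 0 by rewrite oppr_pchar2 // -eT fmorph_eq0.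
rewrite dA -(fmorph_eq0 io) -(mulrI_eq0 _ (mulfI zz0)) (lucas_root _ z0 eT).
rewrite subr_eq0 exprVn; have zn0 : z ^+ n != 0 by rewrite expf_neq0.
rewrite -(inj_eq (mulfI zn0)) divff // -expr2 sqrf_eq1 oppr_pchar2 //.
by rewrite orbb.
Qed.
End Lucas.

(** The relations only bound the order of [x] by [n]. Equality holds because [G] maps onto the
    standard model of order [2 n], while [#|G|] is at most twice the order of [x]. *)
Lemma dihedral_rotation (n : nat) (gT : finGroupType) (G : {group gT}) :
  (1 < n)%N -> is_dihedral n G -> exists2 x, x \in G & #[x]%g = n.
Proof.
move=> n1 dihG; have /existsP[[x y] /= /eqP[defG xn y2 xy]] := isoGrp_hom dihG.
have oG : (n.*2 <= #|G|)%N.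
  rewrite -(card_dihedral n1) leq_homg // dihG.
  exact: isoGrp_hom (Grp_dihedral n1).
rewrite norm_joinEr ?norms_cycle ?xy ?groupV ?cycle_id // in defG.
have Gx : x \in G by rewrite -defG -{1}[x]mulg1 mem_mulg ?cycle_id ?group1.
exists x => //; apply/eqP.
have ox : (#[x]%g %| n)%N by rewrite order_dvdn xn.
have oy : (#[y]%g <= 2)%N by rewrite dvdn_leq // order_dvdn y2.
rewrite eqn_leq dvdn_leq ?(ltnW n1) //= -leq_double.
apply: leq_trans oG _; rewrite -defG -muln2.
apply: leq_trans (leq_mul (leqnn _) oy); rewrite [(_ * _)%N]mul_cardG.
by rewrite leq_pmulr // cardG_gt0.
Qed.

Section Dihedral.
Variables (k ks : fieldType) (iota : {rmorphism k -> ks}) (n : nat).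
Hypotheses (char2 : 2%N \in [pchar k]) (odd_n : odd n).

Lemma dihedral_sub_root (gT : finGroupType) (G : {group gT}) :
  separable_closure iota -> is_dihedral n G ->
  contains_subgroup_isog (PGL2 k) G ->
  exists zeta : ks, n.-primitive_root zeta /\
    exists c : k, iota c = zeta + zeta^-1.
Proof.
case=> _ sep_closed dihG.
case/(contains_subgroup_isogP _ (group_closed_fingroup G)) => f [fM fI].
have [n1|n1] := leqP n 1.
  have {n1} -> : n = 1%N by case: (n) odd_n n1 => [|[]].
  exists 1; split; last first.
    by exists 0; rewrite rmorph0 invr1 -(rmorph1 iota) -rmorphD -mulr2n pcharf0 ?rmorph0.
  by apply: primitive_rootP => // j; rewrite expr1n eqxx dvd1n.
have [x Gx ox] := dihedral_rotation n1 dihG.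
pose A := pgl_lift (f x); pose D := \det A; pose T := \tr A.
have scA j : is_scalar_mx (A ^+ j) = (n %| j)%N.
  rewrite -ox order_dvdn; apply/idP/eqP => [/(lift_scalarX fM fI _ Gx)//|].
  by move/(lift_scalarX fM fI _ Gx).
have D0 : D != 0 by rewrite -unit_mx2E pgl_lift_unit.
have T0 : T != 0.
  apply/negP => /eqP T0.
  have : is_scalar_mx (A ^+ 2).
    by rewrite Cayley_Hamilton2 -/T T0 scale0r add0r -raddfN scalar_mx_is_scalar.
  rewrite scA => /dvdn_leq; move: n1 odd_n; case: (n) => [|[|[|]]] //.
  by move=> ? _ _ /(_ isT).
(* Squaring normalises the determinant to 1 without a square root of [D], and keeps the order of the
   class because [n] is odd. *)
pose B := D^-1 *: A ^+ 2.
have dB : \det B = 1 by rewrite detZ expr2 det_mx2M -/D; field.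
have tB : \tr B = T ^+ 2 / D.
  rewrite linearZ /= Cayley_Hamilton2 linearB linearZ /= mxtrace_scalar.
  by rewrite -[_ *+ 2]mulr_natr pcharf0 // mulr0 subr0 -/T -/D mulrC expr2.
have tB0 : \tr B != 0 by rewrite tB mulf_neq0 ?expf_neq0 ?invr_eq0.
have char2s : 2%N \in [pchar ks] by rewrite (fmorph_pchar iota).
pose t := iota (\tr B); have t0 : t != 0 by rewrite fmorph_eq0.
pose g : {poly ks} := 'X^2 + ((- t) *: 'X + 1).
(* In characteristic 2 the derivative of [g] is the nonzero constant [- t], so [g] is separable. *)
have [z] : exists z, root g z.
  apply: sep_closed.
    rewrite separable_poly.unlock (_ : g^`() = (- t) *: 1).
      by rewrite coprimepZr ?oppr_eq0 // coprimep1.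
    rewrite /g !derivE mul1r mulr1 addr0 -mulr2n (_ : 'X *+ 2 = 0) ?add0r //.
    by rewrite -mulr_natr -polyC_natr pcharf0 // mulr0.
  rewrite size_polyDl ?size_polyXn // (leq_ltn_trans (size_polyD _ _)) //.
  by rewrite gtn_max size_poly1 (leq_ltn_trans (size_scale_leq _ _)) ?size_polyX.
rewrite /root /g !hornerD hornerZ hornerXn hornerX hornerC => /eqP ez.
have z0 : z != 0.
  apply/eqP => z0; move/eqP: ez.
  by rewrite z0 expr0n mulr0 !add0r oner_eq0.
have et : iota (\tr B) = z + z^-1.
  apply: (mulfI z0); rewrite -/t mulrDr divff // -[RHS]subr0 -[in RHS]ez.
  by ring.
exists z; split; last by exists (\tr B).
apply: primitive_rootP => [|j]; first exact: ltnW.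
rewrite -(char2_scalar_expr j char2 dB tB0 z0 et) exprZn -exprM.
have -> : (n %| j)%N = (n %| 2 * j)%N by rewrite Gauss_dvdr // coprimen2.
rewrite -scA; apply/idP/idP => [/is_scalar_mxP[c e]|/is_scalar_mxP[c ->]].
  by apply: scale_is_scalar_mx e; rewrite expf_neq0 ?invr_eq0.
by rewrite scale_scalar_mx scalar_mx_is_scalar.
Qed.
End Dihedral.

Section DihedralModel.
Variable n : nat.
Hypotheses (n1 : (1 < n)%N) (odd_n : odd n).

Let n_gt2 : (2 < n)%N.
Proof. by case: (n) n1 odd_n => [|[|[]]]. Qed.

Definition Zn_opp1 : {unit 'Z_n} := FinRing.Unit (unitrN1 'Z_n).

Lemma Zn_opp1_neq1 : Zn_opp1 != 1%g.
Proof.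
apply/negP => /eqP/(congr1 val)/eqP; rewrite /= eq_sym -addr_eq0 => /eqP e.
have : (2%:R : 'Z_n) = 0 by rewrite mulr2n.
move/(congr1 (@nat_of_ord _)); rewrite val_Zp_nat // => /eqP/dvdn_leq.
by move/(_ isT); rewrite leqNgt n_gt2.
Qed.

Lemma Zn_opp1_sqr : (Zn_opp1 ^+ 2 = 1)%g.
Proof. by apply/val_inj; rewrite FinRing.val_unitX /= sqrrN expr1n. Qed.

Lemma order_Zn_opp1 : #[Zn_opp1]%g = 2%N.
Proof. exact: nt_prime_order Zn_opp1_sqr Zn_opp1_neq1. Qed.

Definition dihedral_model := affine_sub_group 1 Zn_opp1.

Lemma dihedral_modelP (x : affine 'Z_n 1) : x \in dihedral_model ->
  x.2 = 1%g \/ x.2 = Zn_opp1.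
Proof.
by rewrite inE (cycle2g order_Zn_opp1) !inE => /orP[]/eqP; [left | right].
Qed.

Lemma is_dihedral_model : is_dihedral n dihedral_model.
Proof.
apply: (isoGrp_trans _ (Grp_dihedral n1)); apply/(isoGrpP _ (Grp_dihedral n1)).
have cG : #|dihedral_model| = n.*2.
  by rewrite card_affine_sub order_Zn_opp1 card_ord expn1 Zp_cast // muln2.
rewrite card_dihedral //; split=> //.
pose x : affine 'Z_n 1 := (const_mx 1, 1%g).
pose y : affine 'Z_n 1 := (0, Zn_opp1).
have xX i : (x ^+ i)%g = (const_mx i%:R, 1%g).
  rewrite affine_transX; congr pair; apply/matrixP=> a b.
  by rewrite mulmxnE !mxE.
have y2 : (y ^+ 2)%g = 1%g by rewrite affine_rotX Zn_opp1_sqr.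
have xn : (x ^+ n)%g = 1%g.
  by rewrite xX (_ : n%:R = 0) // -(@pchar_Zp n) // pcharf0.
have xy : (x ^ y)%g = (x^-1)%g.
  apply: (mulgI y); rewrite -conjgC; apply: (mulIg x); rewrite mulgKV.
  rewrite !affineM /= scaler0 addr0 mul1g mulg1; congr pair.
  by apply/matrixP=> a b; rewrite !mxE mul1r mulr1 subrr.
have defG : (<[x]> <*> <[y]>)%g = dihedral_model.
  apply/eqP; rewrite eqEsubset join_subG !cycle_subG !inE /= group1 cycle_id /=.
  apply/subsetP=> g Gg.
  have -> : g = ((x ^+ (g.1 0%R 0%R : 'Z_n)) * (y ^+ (g.2 != 1)))%g.
    rewrite xX affine_rotX affineM /= scaler0 addr0 mul1g.
    case: g Gg => v u /dihedral_modelP /= eu; congr pair.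
      by apply/matrixP=> a b; rewrite !ord1 mxE natr_Zp.
    by case: eu => ->; rewrite ?eqxx ?Zn_opp1_neq1.
  by rewrite groupM // groupX // mem_gen // inE cycle_id ?orbT.
apply/existsP; exists (x, y); apply/eqP.
congr (_, _); first exact: defG.
by congr (_, _); [exact: xn | congr (_, _); [exact: y2 | exact: xy]].
Qed.

Lemma dihedral_model_embedding (H : groupType) (b j : H) :
  (forall i, (b ^+ i)%g = 1%g <-> (n %| i)%N) -> (j * j)%g = 1%g ->
  (b * j * b)%g = j -> contains_subgroup_isog H dihedral_model.
Proof.
move=> bn j2 bjb; have bn1 : (b ^+ n = 1)%g by apply/bn.
have bmod i : (b ^+ (i %% (Zp_trunc n).+2))%g = (b ^+ i)%g.
  by rewrite Zp_cast // [in RHS](divn_eq i n) expgD mulnC expgM bn1 expg1n mul1g.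
pose r (a : 'Z_n) := (b ^+ a)%g.
have rD a a' : r (a + a') = (r a * r a')%g.
  by rewrite /r /= bmod expgD.
have r0 : r 0 = 1%g by apply: expg0.
have bjbX i : (b ^+ i * j * b ^+ i)%g = j.
  elim: i => [|i IHi]; first by rewrite expg0 mul1g mulg1.
  rewrite {1}expgSr expgS.
  rewrite (_ : _ * _ = b ^+ i * (b * j * b) * b ^+ i)%g; last by rewrite !mulgA.
  by rewrite bjb.
have jr a : (j * r a)%g = (r (- a) * j)%g.
  by apply: (mulgI (r a)); rewrite !mulgA -rD subrr r0 mul1g bjbX.
pose f (x : affine 'Z_n 1) := (r (x.1 0 0) * j ^+ (x.2 != 1%g))%g.
apply/(contains_subgroup_isogP _ (group_closed_fingroup _)).
have NN1 := negPf Zn_opp1_neq1.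
have fM : {in dihedral_model &, {morph f : x y / (x * y)%g}}.
  move=> [u a] [v c] /dihedral_modelP /= ea /dihedral_modelP /= ec.
  rewrite /f affineM /= !mxE rD.
  case: ea => ->; case: ec => ->; rewrite ?mulg1 ?mul1g ?eqxx ?NN1 /=.
  all: rewrite ?expg0 ?expg1 ?mulg1 ?mul1r ?mulgA //.
  - by rewrite mulN1r -!mulgA jr.
  - rewrite -expg2 Zn_opp1_sqr eqxx expg0 mulg1 mulN1r -!mulgA (mulgA j) jr.
    by rewrite -mulgA j2 mulg1.
exists f; split=> //; apply: closed_morph_inj fM _ => [|g].
  exact: group_closed_fingroup.
case: g => v u /dihedral_modelP /= eu; rewrite /f /=.
case: eu => ->; rewrite ?eqxx ?NN1 /= ?expg0 ?expg1 ?mulg1.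
  move/bn=> dv; congr pair; apply/matrixP=> a c; rewrite !ord1 mxE.
  apply/val_inj => /=; case: (posnP (v 0 0)) => // v0.
  have vn : (v 0%R 0%R < n)%N by rewrite -[X in (_ < X)%N](Zp_cast n1) ltn_ord.
  by have := dvdn_leq v0 dv; rewrite leqNgt vn.
(* A kernel element outside the rotations would give [b ^ v * j = 1]; with [b * j * b = j] this
   yields [b ^ 2 = 1], impossible for [n > 2]. *)
move=> rj; have b2 : (b ^+ 2)%g = 1%g.
  have : (b * (r (v 0%R 0%R) * j) * b = r (v 0%R 0%R) * (b * j * b))%g.
    by rewrite !mulgA -expgS expgSr.
  by rewrite bjb rj mulg1.
have := dvdn_leq (isT : 0 < 2)%N (iffLR (bn 2) b2).
by rewrite leqNgt n_gt2.
Qed.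
End DihedralModel.

Lemma is_dihedral1 (gT : finGroupType) (t : gT) :
  #[t]%g = 2%N -> is_dihedral 1 <[t]>%G.
Proof.
move=> ot; have t2 : (t ^+ 2 = 1)%g by rewrite -ot expg_order.
apply: intro_isoGrp => [|rT H].
  apply/existsP; exists (1%g, t).
  by rewrite /= cycle1 joing1G conj1g invg1 expg1 t2.
case/existsP=> -[x y] /= /eqP[defH x1 y2 _].
have dv : (#[y]%g %| #[t]%g)%N by rewrite ot order_dvdn y2.
have -> : (H = <[y]> :> {set rT})%g by rewrite -defH -[x]expg1 x1 cycle1 joing1G.
by rewrite -(im_eltm dv) morphim_homg.
Qed.

Section Dihedral.
Variables (k ks : fieldType) (iota : {rmorphism k -> ks}) (n : nat).
Hypotheses (char2 : 2%N \in [pchar k]) (odd_n : odd n).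

Lemma dihedral_root_sub (zeta : ks) (c : k) :
  n.-primitive_root zeta -> iota c = zeta + zeta^-1 ->
  exists (gT : finGroupType) (G : {group gT}),
    is_dihedral n G /\ contains_subgroup_isog (PGL2 k) G.
Proof.
move=> prim_z ec; have two0 (x : k) : x + x = 0.
  by rewrite -mulr2n -mulr_natr pcharf0 ?mulr0.
pose J : 'M[k]_2 := mx2 0 1 1 0.
have uJ : J \is a GRing.unit.
  by rewrite unit_mx2E det_mx2 mul0r mul1r sub0r oppr_eq0 oner_eq0.
have J2 : J * J = 1.
  rewrite mx2M; transitivity (1%:M : 'M[k]_2) => //.
  by rewrite mx2_scalar; congr mx2; ring.
have j2 : (pgl J * pgl J)%g = 1%g by rewrite -pglM // J2 pgl1.
have [n1|n1] := leqP n 1.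
  have {n1} -> : n = 1%N by case: (n) odd_n n1 => [|[]].
  exists 'Z_2, <[Zp1]>%G; split; first by apply: is_dihedral1; apply: order_Zp1.
  apply/(contains_subgroup_isogP _ (group_closed_fingroup _)).
  exists (fun i : 'Z_2 => (pgl J ^+ i)%g).
  have J1 : pgl J != 1%g.
    apply/eqP; rewrite pgl_eq1 // => /mx2_scalarP[_ /eqP].
    by rewrite oner_eq0.
  split=> [i j _ _ /=|[[|[|//]] i] [[|[|//]] j] _ _ /= e]; last 4 first.
  - exact/val_inj.
  - by case/eqP: J1; rewrite -[LHS]expg1 -e.
  - by case/eqP: J1; rewrite -[LHS]expg1 e.
  - exact/val_inj.
  rewrite -expgD [in RHS](divn_eq (i + j) 2) expgD mulnC expgM.
  by rewrite -[(pgl J ^+ 2)%g]/(pgl J * pgl J)%g j2 expg1n mul1g.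
have z0 : zeta != 0.
  apply/eqP=> z0; have := prim_expr_order prim_z.
  by rewrite z0 expr0n gtn_eqF ?(ltnW n1) // => /esym/eqP; rewrite oner_eq0.
(* Otherwise [zeta ^ 2 = 1], and the odd number [n > 1] would divide 2. *)
have c0 : c != 0.
  rewrite -(fmorph_eq0 iota) ec; apply/eqP => e.
  have : zeta ^+ 2 = 1.
    apply/eqP; rewrite -subr_eq0 oppr_pchar2; last by rewrite (fmorph_pchar iota).
    by rewrite -(mulr0 zeta) -e mulrDr divff.
  move/eqP; rewrite -(prim_order_dvd prim_z) => /dvdn_leq.
  by case: (n) n1 odd_n => [|[|[|]]] // ? _ _ /(_ isT).
pose B := mx2 0 1 1 c.
have dB : \det B = 1 by rewrite det_mx2 mul0r mul1r sub0r oppr_pchar2.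
have tB : \tr B = c by rewrite tr_mx2 add0r.
have uB : B \is a GRing.unit by rewrite unit_mx2E dB oner_eq0.
exists (affine 'Z_n 1), (dihedral_model n); split.
  exact: is_dihedral_model.
apply: (@dihedral_model_embedding _ n1 odd_n _ (pgl B) (pgl J)) => //.
  move=> i; rewrite -pglX // pgl_eq1 ?unitrX //.
  by rewrite (@char2_scalar_expr _ _ iota _ zeta) ?tB // (prim_order_dvd prim_z).
rewrite -!pglM ?unitrMl //; congr pgl; rewrite !mx2M; congr mx2; try ring.
by rewrite -[RHS](two0 c); ring.
Qed.
End Dihedral.

(** * The alternating group in characteristic three *)

Lemma alt5_sub_F9 (k : fieldType) : 3%N \in [pchar k] ->
  contains_subgroup_isog (PGL2 k) ('Alt_('I_5))%g -> contains_Fq k 9.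
Proof.
move=> char3; case/(contains_subgroup_isogP _ (group_closed_fingroup _)) => f [fM fI].
have [x Gx ox] : exists2 x, x \in ('Alt_('I_5))%g & #[x]%g = 5%N.
  have dv : (5 %| #|('Alt_('I_5))%g|)%N.
    have := @card_Alt 'I_5; rewrite card_ord => /(_ isT) cA.
    by rewrite -(@Gauss_dvdr 5 2) // cA.
  by have [x] := Cauchy (isT : prime 5) dv; exists x.
pose A := pgl_lift (f x).
have scA j : is_scalar_mx (A ^+ j) = (5 %| j)%N.
  rewrite -ox order_dvdn; apply/idP/eqP => [/(lift_scalarX fM fI _ Gx)//|].
  by move/(lift_scalarX fM fI _ Gx).
have nsA : ~~ is_scalar_mx A by have := scA 1%N; rewrite expr1 => ->.
have D0 : \det A != 0 by rewrite -unit_mx2E pgl_lift_unit.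
have /eqP e : lucas (\tr A) (\det A) 5 == 0 by rewrite -expr_mx2_scalar // scA.
have three0 : 3%:R = 0 :> k by rewrite pcharf0.
pose T := \tr A; pose D := \det A.
(* [U_5 = T^4 - 3 T^2 D + D^2], whose middle term vanishes in characteristic 3. *)
have {}e : T ^+ 4 + D ^+ 2 = 0.
  rewrite -[RHS]e -/T -/D -[LHS]addr0 -(mul0r (- (T ^+ 2 * D))) -three0.
  by rewrite /lucas; ring.
pose i := T ^+ 2 / D.
have i2 : i ^+ 2 = -1.
  apply: (mulIf (expf_neq0 2 D0)); rewrite -exprMn divfK // mulN1r -exprM.
  by apply/eqP; rewrite -addr_eq0 e.
apply: (@contains_Fq_prim_root _ 3 char3 2 4 i).
  by split=> // -[|[|d]].
apply: primitive_rootP => // j.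
have N1 : (-1 == 1 :> k) = false.
  apply/negP; rewrite eq_sym -addr_eq0 -[1 + 1]/(2%:R : k).
  by rewrite -(dvdn_pcharf char3).
have i4 : i ^+ 4 = 1 by rewrite (exprM i 2 2) i2 sqrrN expr1n.
rewrite (divn_eq j 4) exprD mulnC exprM i4 expr1n mul1r dvdn_addr ?dvdn_mulr //.
case: (j %% 4)%N (ltn_pmod j (isT : 0 < 4)%N) => [|[|[|[|]]]] // _.
- by rewrite expr0 eqxx.
- by apply/eqP; rewrite expr1 => i1; move/eqP: i2; rewrite i1 expr1n eq_sym N1.
- by rewrite i2 N1.
apply/eqP => /= i3; move/eqP: i4; rewrite exprS i3 mulr1 => /eqP i1.
by move/eqP: i2; rewrite i1 expr1n eq_sym N1.
Qed.

(* [(a, b)] stands for [a + b i] in [F_3[i]], and a quadruple for a matrix     *)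
(* listed by rows.                                                            *)
Definition f9 : Type := (nat * nat)%type.
Definition f9_one : f9 := (1, 0)%N.
Definition f9_add (x y : f9) : f9 := ((x.1 + y.1) %% 3, (x.2 + y.2) %% 3)%N.
Definition f9_mul (x y : f9) : f9 :=
  ((x.1 * y.1 + 2 * (x.2 * y.2)) %% 3, (x.1 * y.2 + x.2 * y.1) %% 3)%N.
Definition f9_opp (x : f9) : f9 := f9_mul (2, 0)%N x.
(** An explicit inverse is what carries nonvanishing over to [k], see [f9_unit_val]. *)
Definition f9_unit (x : f9) : bool :=
  has (fun a => has (fun b => f9_mul x (a, b) == f9_one) (iota 0 3)) (iota 0 3).

Definition m9 : Type := (f9 * f9 * f9 * f9)%type.
Definition m9_one : m9 := (f9_one, (0, 0), (0, 0), f9_one)%N.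
Definition m9_mul (A B : m9) : m9 :=
  let: (a, b, c, d) := A in let: (a', b', c', d') := B in
  (f9_add (f9_mul a a') (f9_mul b c'), f9_add (f9_mul a b') (f9_mul b d'),
   f9_add (f9_mul c a') (f9_mul d c'), f9_add (f9_mul c b') (f9_mul d d')).
Definition m9_opp (A : m9) : m9 :=
  let: (a, b, c, d) := A in (f9_opp a, f9_opp b, f9_opp c, f9_opp d).
Definition m9_det (A : m9) : f9 :=
  let: (a, b, c, d) := A in f9_add (f9_mul a d) (f9_opp (f9_mul b c)).
Definition m9_nonscalar (A : m9) : bool :=
  let: (a, b, c, d) := A in
  [|| f9_unit b, f9_unit c | f9_unit (f9_add a (f9_opp d))].

(** Permutations are lists of values, and [s] acts first, as in the product of [{perm 'I_5}]. *)
Definition lcomp (s t : seq nat) : seq nat := map (nth 0%N t) s.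
Definition lswap (x y : nat) : seq nat :=
  [seq if i == x then y else if i == y then x else i | i <- iota 0 5].

(* The images [0 1; -1 0] and [i i; 1 1-i] of the generators (0 1)(2 3) and   *)
(* (1 2 4) of the alternating group satisfy its (2,3,5) presentation up to    *)
(* sign.                                                                      *)
Definition alt5_gens : seq (seq nat * m9) :=
  [:: ([:: 1; 0; 3; 2; 4], ((0, 0), (1, 0), (2, 0), (0, 0)));
      ([:: 0; 2; 4; 3; 1], ((0, 1), (0, 1), (1, 0), (1, 2)))]%N.

(** One round of breadth-first search in the Cayley graph, the first word reaching a permutation
    fixing its lift. *)
Definition alt5_step (T : seq (seq nat * m9)) : seq (seq nat * m9) :=
  foldl (fun T x => if x.1 \in unzip1 T then T else rcons T x) T
    [seq (lcomp x.1 g.1, m9_mul x.2 g.2) | x <- T, g <- alt5_gens].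

Definition alt5_table : seq (seq nat * m9) :=
  iter 12 alt5_step [:: (iota 0 5, m9_one)].

Definition alt5_lift (s : seq nat) : m9 :=
  (nth (iota 0 5, m9_one) alt5_table (index s (unzip1 alt5_table))).2.

(* The table and the function [lift] are hidden behind an existential         *)
(* statement so that conversion never evaluates them again.                   *)
Lemma alt5_lift_exists : exists (T : seq (seq nat)) (lift : seq nat -> m9),
  [/\ iota 0 5 \in T,
      all (fun s => all (fun x => all (fun y => (x == y) ||
          ((lcomp (lswap x y) s \in T) == (s \notin T))) (iota 0 5)) (iota 0 5))
        (permutations (iota 0 5)),
      all (fun s => all (fun t => let A := m9_mul (lift s) (lift t) in
          lift (lcomp s t) \in [:: A; m9_opp A]) T) T,
      all (fun s => m9_det (lift s) == f9_one) T
    & all (fun s => (s == iota 0 5) || m9_nonscalar (lift s)) T].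
Proof.
by exists (unzip1 alt5_table), alt5_lift; split; vm_compute.
Qed.

Definition perm_seq (s : {perm 'I_5}) : seq nat := [seq val (s i) | i <- enum 'I_5].

Lemma nth_perm_seq s (i : 'I_5) : nth 0%N (perm_seq s) i = s i.
Proof. by rewrite (nth_map ord0) ?size_enum_ord // nth_ord_enum. Qed.

Lemma perm_seqM s t : perm_seq (s * t)%g = lcomp (perm_seq s) (perm_seq t).
Proof.
rewrite /lcomp -map_comp; apply: eq_map => i.
by rewrite /= nth_perm_seq permM.
Qed.

Lemma perm_seq1 : perm_seq 1%g = iota 0 5.
Proof. by rewrite -val_enum_ord; apply: eq_map => i; rewrite perm1. Qed.

Lemma perm_seq_inj : injective perm_seq.
Proof.
move=> s t e; apply/permP=> i; apply/val_inj.
by rewrite /= -!nth_perm_seq e.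
Qed.

Lemma perm_seq_tperm (x y : 'I_5) : perm_seq (tperm x y) = lswap x y.
Proof.
rewrite /lswap -val_enum_ord -map_comp; apply: eq_map => i /=.
rewrite !val_eqE; case: tpermP => [->|->|/eqP/negPf-> /eqP/negPf->] //.
  by rewrite eqxx.
by rewrite eqxx; case: eqP => // ->.
Qed.

Lemma perm_seq_permutations s : perm_seq s \in permutations (iota 0 5).
Proof.
rewrite mem_permutations -val_enum_ord /perm_seq (map_comp val s).
apply: perm_map; apply: uniq_perm; rewrite ?(map_inj_uniq (@perm_inj _ s)) ?enum_uniq //.
by move=> i; rewrite mem_enum -(permKV s i) mem_map ?mem_enum //; apply: perm_inj.
Qed.

(** Membership in [T] flips with each transposition, as parity does, and a permutation is a product
    of transpositions. *)
Lemma even_perm_seq (T : seq (seq nat)) (s : {perm 'I_5}) :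
  iota 0 5 \in T ->
  all (fun s => all (fun x => all (fun y => (x == y) ||
      ((lcomp (lswap x y) s \in T) == (s \notin T))) (iota 0 5)) (iota 0 5))
    (permutations (iota 0 5)) ->
  (perm_seq s \in T) = ~~ odd_perm s.
Proof.
move=> T1 Tswap; have [ts -> _] := prod_tpermP s.
elim: ts => [|[x y] ts IHts].
  by rewrite big_nil perm_seq1 odd_perm1 T1.
rewrite big_cons /= odd_mul_tperm perm_seqM perm_seq_tperm.
move: IHts; set t := (\prod_(i <- ts) _)%g => IHts.
have [<-|xy] := eqVneq x y.
  by rewrite -perm_seq_tperm -perm_seqM tperm1 mul1g.
have xI : val x \in iota 0 5 by rewrite mem_iota ltn_ord.
have yI : val y \in iota 0 5 by rewrite mem_iota ltn_ord.
have := allP (allP (allP Tswap _ (perm_seq_permutations t)) _ xI) _ yI.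
by rewrite val_eqE (negPf xy) => /eqP->; rewrite IHts.
Qed.

Section Alt5.
Variables (k : fieldType) (i : k).
Hypotheses (char3 : 3%N \in [pchar k]) (i2 : i ^+ 2 = -1).

Definition f9_val (x : f9) : k := x.1%:R + x.2%:R * i.
Definition m9_val (A : m9) : 'M[k]_2 :=
  let: (a, b, c, d) := A in mx2 (f9_val a) (f9_val b) (f9_val c) (f9_val d).

Lemma f9_valD x y : f9_val (f9_add x y) = f9_val x + f9_val y.
Proof. by rewrite /f9_val /= !(GRing.natr_mod_pchar char3) !natrD; ring. Qed.

Lemma f9_valM x y : f9_val (f9_mul x y) = f9_val x * f9_val y.
Proof.
have two2 (a : k) : a + (a + 0) = a * i ^+ 2.
  rewrite i2 mulrN1 addr0; apply/eqP; rewrite -addr_eq0.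
  by rewrite -mulr2n -mulrSr -mulr_natr pcharf0 ?mulr0.
rewrite /f9_val /= !(GRing.natr_mod_pchar char3) !natrD !natrM two2.
by ring.
Qed.

Lemma f9_val1 : f9_val f9_one = 1.
Proof. by rewrite /f9_val mul0r addr0. Qed.

Lemma f9_valN x : f9_val (f9_opp x) = - f9_val x.
Proof.
rewrite f9_valM {1}/f9_val mul0r addr0 -mulN1r; congr (_ * _).
by apply/eqP; rewrite -addr_eq0 natr1 pcharf0.
Qed.

Lemma f9_unit_val x : f9_unit x -> f9_val x != 0.
Proof.
case/hasP=> a _ /hasP[b _ /eqP/(congr1 f9_val)]; rewrite f9_valM f9_val1.
by apply: contra_eq_neq => ->; rewrite mul0r eq_sym oner_eq0.
Qed.

Lemma m9_valM A B : m9_val (m9_mul A B) = m9_val A * m9_val B.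
Proof.
case: A B => [[[a b] c] d] [[[a' b'] c'] d'].
by rewrite /= mx2M !f9_valD !f9_valM.
Qed.

Lemma m9_valN A : m9_val (m9_opp A) = - m9_val A.
Proof.
by case: A => [[[a b] c] d]; rewrite /= !f9_valN -[RHS]scaleN1r mx2Z !mulN1r.
Qed.

Lemma det_m9_val A : \det (m9_val A) = f9_val (m9_det A).
Proof.
by case: A => [[[a b] c] d]; rewrite /= det_mx2 f9_valD f9_valN !f9_valM.
Qed.

Lemma m9_nonscalar_val A : m9_nonscalar A -> ~~ is_scalar_mx (m9_val A).
Proof.
case: A => [[[a b] c] d] /= ns; apply/negP => /mx2_scalarP[ad b0 c0].
case/or3P: ns => /f9_unit_val; rewrite ?b0 ?c0 ?eqxx //.
by rewrite f9_valD f9_valN ad subrr eqxx.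
Qed.

(** The table lifts even permutations to matrices of determinant 1, multiplicatively up to sign; the
    sign disappears in [PGL2 k], and only the identity has a scalar lift. *)
Lemma alt5_sub : contains_subgroup_isog (PGL2 k) ('Alt_('I_5))%g.
Proof.
apply/(contains_subgroup_isogP _ (group_closed_fingroup _)).
have [T [lift [T1 Tswap liftM lift_det lift_ns]]] := alt5_lift_exists.
pose M (s : {perm 'I_5}) := m9_val (lift (perm_seq s)).
have mem_table s : s \in ('Alt_('I_5))%g -> perm_seq s \in T.
  by rewrite Alt_even even_perm_seq.
have uM s : s \in ('Alt_('I_5))%g -> M s \is a GRing.unit.
  move/mem_table => As; rewrite unit_mx2E det_m9_val.
  by rewrite (eqP (allP lift_det _ As)) f9_val1 oner_eq0.
pose f s := pgl (M s).
have fM : {in ('Alt_('I_5))%g &, {morph f : s t / (s * t)%g}}.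
  move=> s t As At; rewrite /f -pglM ?uM // pglP ?unitrMl ?uM ?groupM //.
  have := allP (allP liftM _ (mem_table s As)) _ (mem_table t At).
  rewrite /= -perm_seqM !inE => /orP[]/eqP e.
    by exists 1; rewrite ?oner_eq0 // scale1r /M e m9_valM.
  by exists (-1); rewrite ?oppr_eq0 ?oner_eq0 // scaleN1r /M e m9_valN m9_valM.
exists f; split=> //; apply: closed_morph_inj fM _ => [|s As].
  exact: group_closed_fingroup.
rewrite pgl_eq1 ?uM // => sc; apply: perm_seq_inj; rewrite perm_seq1.
have := allP lift_ns _ (mem_table s As).
by case: eqP => //= _ /m9_nonscalar_val; rewrite sc.
Qed.
End Alt5.

Lemma contains_F9_sqrtN1 (k : fieldType) :
  contains_Fq k 9 -> exists i : k, i ^+ 2 = -1.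
Proof.
case=> F cF [io]; have [|u ou] := @finField_unit_order F 4; first by rewrite cF.
exists (io (val u)); rewrite -rmorphXn -(rmorph1 io) -rmorphN /=; congr (io _).
have prim_u := unit_prim_root u; rewrite ou in prim_u.
have /eqP : (val u ^+ 2) ^+ 2 = 1 by rewrite -exprM prim_expr_order.
rewrite sqrf_eq1 => /orP[|/eqP//].
by rewrite -(prim_order_dvd prim_u).
Qed.

Local Close Scope ring_scope.

Theorem theoremA (k : fieldType) (p : nat) (charkp : p \in [pchar k]%R) :
  [/\
      forall (r : nat) (Fq : finFieldType), (0 < r)%N -> #|Fq| = (p ^ r)%N ->
        (contains_subgroup_isog (PGL2 k) (H := PGL2 Fq) predT
           <-> contains_Fq k (p ^ r)) /\
        (contains_subgroup_isog (PGL2 k) (PSL2 Fq)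
           <-> contains_Fq k (p ^ r)),
      forall m n e : nat, (0 < m)%N -> ~~ (p %| n)%N -> is_order_mod n p e ->
        (exists (gT : finGroupType) (G : {group gT}),
           [/\ p_semi_elementary p G, #|G| = (p ^ m * n)%N
             & contains_subgroup_isog (PGL2 k) G])
        <-> [/\ contains_Fq k (p ^ e), (e %| m)%N
              & le_dim m (pPrimeCharType charkp : lmodType 'F_p)],
      p = 2 ->
        forall (n : nat) (ks : fieldType) (iota : {rmorphism k -> ks}),
        odd n -> separable_closure iota ->
        (exists (gT : finGroupType) (G : {group gT}),
           is_dihedral n G /\ contains_subgroup_isog (PGL2 k) G)
        <-> (exists zeta : ks, (n.-primitive_root zeta)%R /\
               exists c : k, iota c = (zeta + zeta^-1)%R)
    &
      p = 3 ->
        contains_subgroup_isog (PGL2 k) ('Alt_('I_5))%g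
        <-> contains_Fq k 9].
Proof.
have p_pr := pcharf_prime charkp; split.
- move=> r Fq r0 cFq; have PSLF := contains_PSL2_Fq charkp r0 cFq.
  have FPGL := contains_PGL2 charkp r0 cFq.
  split; split; [by move/contains_PGL2_PSL2/PSLF | exact: FPGL | exact: PSLF |].
  by move/FPGL/contains_PGL2_PSL2.
- move=> m n e m0 pn ord_e; split=> [[gT [G [semiG cG]]]|[Fe em dim_m]].
    exact: semi_elementary_sub pn ord_e semiG cG.
  exact: semi_elementary_exists ord_e Fe em dim_m.
- move=> p2 n ks iota odd_n sep_ks; rewrite p2 in charkp.
  split=> [[gT [G [dihG]]]|[zeta [prim_zeta [c ec]]]].
    exact: dihedral_sub_root charkp odd_n gT G sep_ks dihG.
  exact: dihedral_root_sub charkp odd_n _ _ prim_zeta ec.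
move=> p3; rewrite p3 in charkp; split; first exact: alt5_sub_F9.
by case/contains_F9_sqrtN1=> i; apply: alt5_sub.
Qed.
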